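(* Let $r\in\mathbb{N}$, $r\ge 1$, and let $0<\lambda_1<1<\lambda_2$ satisfy $\frac{\lambda_1^r+\lambda_2^r}{2}<1$. Then for any function $\phi\in C^r(\mathbb{R})$ with $\|\phi^{(r)}\|_{C^0}=\sup_{x\in\mathbb{R}}|\phi^{(r)}(x)|<\infty$, the function $h(\epsilon):=\int_{\mathbb{R}}\phi\,d\mu_{\lambda_1+\epsilon,\lambda_2}$ (defined for $|\epsilon|$ small) is differentiable at $0$ up to order $r$, and its derivatives coincide with those obtained by formally differentiating under the integral: for $l=1,2,\dots,r$, $$h^{(l)}(0)=\int_{\Sigma}\frac{d^l}{d\epsilon^l}\big(\phi\circ X(\epsilon)\big)\Big|_{\epsilon=0}\,d\nu=\int_{\Sigma}\ \sum_{k_1+2k_2+\cdots+lk_l=l}L(k_1,\dots,k_l)\,\phi^{(k)}(X)\prod_{j=1}^{l}\big(X^{(j)}\big)^{k_j}\,d\nu,$$ where the sum is over all non-negative integers $k_1,\dots,k_l$ with $k_1+2k_2+\cdots+lk_l=l$, $k:=k_1+\cdots+k_l$, and $L(k_1,\dots,k_l):=\frac{l!}{k_1!(1!)^{k_1}\cdots k_l!(l!)^{k_l}}$.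
   Context: Fix $d_1,d_2\in\mathbb{R}$ such that the maps $f_1(x)=\lambda_1x+d_1$ and $f_2(x)=\lambda_2x+d_2$ do not have the same fixed point, i.e. $\frac{d_1}{1-\lambda_1}\ne\frac{d_2}{1-\lambda_2}$. For $0<a<1<b$ with $ab<1$, $\mu_{a,b}$ denotes the unique stationary measure of the iterated function system $x\mapsto ax+d_1$, $x\mapsto bx+d_2$ with probabilities $(\frac12,\frac12)$, i.e. the unique Borel probability measure $\mu$ on $\mathbb{R}$ equal to $\frac12$ of its push-forward by the first map plus $\frac12$ of its push-forward by the second map. (The hypothesis $\frac{\lambda_1^r+\lambda_2^r}{2}<1$ implies $\lambda_1\lambda_2<1$.) $\Sigma=\{1,2\}^{\mathbb{N}}$ with elements $(i_1,i_2,\dots)$, and $\nu=(\frac12,\frac12)^{\mathbb{N}}$ is the Bernoulli measure on $\Sigma$. For $|\epsilon|$ small enough that $0<\lambda_1+\epsilon<1$ and $(\lambda_1+\epsilon)\lambda_2<1$, put $\lambda_1(\epsilon)=\lambda_1+\epsilon$, $\lambda_2(\epsilon)=\lambda_2$ and $$X(\epsilon)=\sum_{m=0}^{\infty}\lambda_{i_1}(\epsilon)\cdots\lambda_{i_m}(\epsilon)\,d_{i_{m+1}}$$ (empty product $=1$), which converges $\nu$-almost everywhere and has law $\mu_{\lambda_1+\epsilon,\lambda_2}$; $X:=X(0)$. The random variable $X^{(j)}$, $j\ge1$, is the (term by term) $j$-th derivative of $X(\epsilon)$ at $\epsilon=0$: $$X^{(j)}=\frac{j!}{\lambda_1^j}\sum_{m=1}^{\infty}\lambda_{i_1}\cdots\lambda_{i_m}\,d_{i_{m+1}}\binom{o(m)}{j},$$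 where $o(m)$ is the number of $1$'s among $i_1,\dots,i_m$, and $\binom{n}{k}=0$ if $k>n$. *)

(* Defs.v *)
From HB Require Import structures.
From mathcomp Require Import all_boot all_order all_algebra.
From mathcomp Require Import archimedean.
From mathcomp Require Import all_classical all_reals all_analysis.
From mathcomp Require Import ring lra zify.

Set Implicit Arguments.
Unset Strict Implicit.
Unset Printing Implicit Defensive.

Import Order.TTheory GRing.Theory Num.Theory.
Import numFieldNormedType.Exports.

Local Open Scope classical_set_scope.
Local Open Scope ring_scope.

(* The letters 1 and 2 are encoded by true and false, and the sequence
   (i_1, i_2, ...) by w with w m = i_{m+1}: coordinates are numbered from 0. *)
Definition cylinder (w : nat -> bool) (n : nat) : set (nat -> bool) :=
  [set x | forall i, (i < n)%N -> x i = w i].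

Definition cylinders : set (set (nat -> bool)) :=
  [set A | exists w n, A = cylinder w n].

Definition Sigma := g_sigma_algebraType cylinders.

Definition is_bernoulli (R : realType) (nu : probability Sigma R) : Prop :=
  forall (w : nat -> bool) (n : nat), nu (cylinder w n) = (2^-1 ^+ n)%:E.

(* [get P] is an element of P when P is nonempty: see bernoulliP. *)
Definition bernoulli_nu (R : realType) : probability Sigma R :=
  get [set nu | is_bernoulli nu].

Section bernoulli_existence.
Variable R : realType.

Let unit_itv : set R := `[0, 1[.
Let munit_itv : measurable (unit_itv : set (measurableTypeR R)).
Proof. exact: measurable_itv. Qed.

Local Definition unif := mrestr (@lebesgue_measure R) munit_itv.
HB.instance Definition _ := Measure.on unif.

Let unif_setT : unif setT = 1%E.
Proof.
rewrite /unif /mrestr setTI /unit_itv lebesgue_measure_itv/= lte_fin ltr01.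
by rewrite oppr0 adde0.
Qed.
HB.instance Definition _ := @Measure_isProbability.Build _ _ R unif unif_setT.

Local Definition digits (x : measurableTypeR R) : Sigma :=
  fun n => odd (Num.truncn (x * 2 ^+ n.+1)).

Let measurable_le_truncn c k : 0 < c ->
  measurable [set x : measurableTypeR R | (Num.truncn (x * c) <= k)%N].
Proof.
move=> c0.
suff -> : [set x : R | (Num.truncn (x * c) <= k)%N] = `]-oo, (k.+1%:R / c)[%classic.
  exact: measurable_itv.
apply/seteqP; split => x /=; rewrite in_itv/= truncn_le_nat ltr_pdivlMr//.
Qed.

Let measurable_eq_truncn c k : 0 < c ->
  measurable [set x : measurableTypeR R | Num.truncn (x * c) = k].
Proof.
move=> c0; case: k => [|k].
  suff -> : [set x : R | Num.truncn (x * c) = 0%N] =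
    [set x : R | (Num.truncn (x * c) <= 0)%N] by exact: measurable_le_truncn.
  by apply/seteqP; split => x /=; lia.
suff -> : [set x : R | Num.truncn (x * c) = k.+1] =
    [set x : R | (Num.truncn (x * c) <= k.+1)%N] `\`
    [set x : R | (Num.truncn (x * c) <= k)%N].
  by apply: measurableD; exact: measurable_le_truncn.
by apply/seteqP; split => x /=; lia.
Qed.

Let measurable_digits : measurable_fun setT digits.
Proof.
apply: (@measurability _ _ _ Sigma _ _ (cylinders : set (set Sigma))) => //.
move=> _ [_ [w [n ->]] <-]; rewrite setTI.
suff -> : digits @^-1` cylinder w n = \bigcap_(i in `I_n) \bigcup_(k in [set k | odd k = w i])
    [set x : R | Num.truncn (x * 2 ^+ i.+1) = k].
  apply: bigcap_measurableType => i _; apply: bigcup_measurable => k _.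
  by apply: measurable_eq_truncn; exact: exprn_gt0.
apply/seteqP; split => x /=.
  by move=> H i /= /H dx; exists (Num.truncn (x * 2 ^+ i.+1)).
by move=> H i /= /H[k /= <- <-].
Qed.
HB.instance Definition _ := isMeasurableFun.Build _ _ _ _ digits measurable_digits.

Let prefix (w : nat -> bool) n : nat := iteri n (fun i k => w i + k.*2)%N 0%N.

Let prefix_lt w n : (prefix w n < 2 ^ n)%N.
Proof.
elim: n => // n IH; rewrite /prefix/= -/(prefix w n) expnS.
by case: (w n); lia.
Qed.

Let digits_prefix (x : R) w n : unit_itv x ->
  (forall i, (i < n)%N -> digits x i = w i) <-> Num.truncn (x * 2 ^+ n) = prefix w n.
Proof.
rewrite /unit_itv/= in_itv/= => /andP[x0 x1]; elim: n => [|n IH].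
  split=> // _; rewrite expr0 mulr1 /prefix/=.
  by apply/eqP; rewrite truncn_eq// x0 x1.
have y0 : 0 <= x * 2 ^+ n.+1 by rewrite mulr_ge0// exprn_ge0.
have half : (Num.truncn (x * 2 ^+ n.+1))./2 = Num.truncn (x * 2 ^+ n).
  apply/esym/eqP; rewrite truncn_eq ?mulr_ge0 ?exprn_ge0//.
  have /andP[] := truncn_itv y0.
  move: (Num.truncn _) => t; rewrite exprS mulrCA.
  move: (x * _) => y ty yt.
  have : (t./2.*2 <= t)%N by lia.
  have : (t.+1 <= t./2.+1.*2)%N by lia.
  rewrite -!(ler_nat R) -!muln2 !natrM => h1 h2.
  by apply/andP; split; lra.
have dE : digits x n = odd (Num.truncn (x * 2 ^+ n.+1)) by [].
rewrite /prefix/= -/(prefix w n); split.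
  move=> H.
  have /IH : forall i, (i < n)%N -> digits x i = w i by move=> i ni; apply: H; lia.
  have := H n (ltnSn n); rewrite dE -half => <- <-.
  by rewrite odd_double_half.
move=> tE.
have wn : odd (Num.truncn (x * 2 ^+ n.+1)) = w n.
  by rewrite tE oddD odd_double addbF; case: (w n).
have pn : Num.truncn (x * 2 ^+ n) = prefix w n.
  by rewrite -half tE; case: (w n); lia.
move=> i; rewrite ltnS leq_eqVlt => /predU1P[->|]; first by rewrite dE.
by case: IH => _ /(_ pn); apply.
Qed.

Let bernoulli_exists : exists nu : probability Sigma R, is_bernoulli nu.
Proof.
exists (distribution unif digits) => w n.
have p0 : 0 < 2 ^+ n :> R by exact: exprn_gt0.
suff E : digits @^-1` cylinder w n `&` unit_itv =
    `[(prefix w n)%:R / 2 ^+ n, (prefix w n).+1%:R / 2 ^+ n[%classic.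
  change (lebesgue_measure (digits @^-1` cylinder w n `&` unit_itv) = (2^-1 ^+ n)%:E).
  rewrite E.
  rewrite lebesgue_measure_itv/= lte_fin ltr_pM2r ?invr_gt0// ltr_nat ltnSn.
  by rewrite -EFinB -mulrBl -natrB// subSnn mul1r exprVn.
apply/seteqP; split => x.
  move=> [+ x01]; rewrite /preimage /cylinder/= => /(digits_prefix w n x01) /eqP.
  move: x01; rewrite /unit_itv/= in_itv/= => /andP[x0 x1].
  rewrite truncn_eq ?mulr_ge0 ?exprn_ge0//.
  by rewrite in_itv/= ler_pdivrMr// ltr_pdivlMr.
rewrite /= in_itv/= ler_pdivrMr// ltr_pdivlMr// => /andP[a b].
have x0 : 0 <= x by rewrite -(pmulr_lge0 _ p0) (le_trans _ a).
have x01 : unit_itv x.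
  rewrite /unit_itv/= in_itv/= x0/= -(ltr_pM2r p0) mul1r (lt_le_trans b)//.
  by rewrite -natrX ler_nat prefix_lt.
split=> //; apply/(digits_prefix w n x01)/eqP.
by rewrite truncn_eq ?mulr_ge0 ?exprn_ge0// a b.
Qed.

Lemma bernoulliP : is_bernoulli (bernoulli_nu R).
Proof.
case: bernoulli_exists => nu nuP.
exact: (getPex (ex_intro _ nu nuP)).
Qed.

End bernoulli_existence.

Definition is_stationary (R : realType) (d1 d2 a b : R)
    (mu : probability (measurableTypeR R) R) : Prop :=
  forall A : set (measurableTypeR R), measurable A ->
    mu A = ((2^-1)%:E * pushforward mu (fun x => a * x + d1)%R A
          + (2^-1)%:E * pushforward mu (fun x => b * x + d2)%R A)%E.

(* For 0 < a < 1 < b with a * b < 1 the stationary probability exists and is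
   unique; otherwise this is an arbitrary probability. *)
Definition stationary_measure (R : realType) (d1 d2 a b : R) :
    probability (measurableTypeR R) R :=
  get [set mu | is_stationary d1 d2 a b mu].

Definition letter (T : Type) (t1 t2 : T) (s : bool) : T := if s then t1 else t2.

(* lambda_{i_1} ... lambda_{i_m} *)
Definition weight (R : realType) (l1 l2 : R) (w : Sigma) (m : nat) : R :=
  \prod_(k < m) letter l1 l2 (w k).

Definition ones (w : Sigma) (m : nat) : nat := (\sum_(k < m) w k)%N.

Definition X (R : realType) (l1 l2 d1 d2 : R) (w : Sigma) : R :=
  limn (series (fun m => weight l1 l2 w m * letter d1 d2 (w m))).

(* Summand m of the series is the term of index m.+1 of the sum over m >= 1. *)
Definition Xder (R : realType) (l1 l2 d1 d2 : R) (j : nat) (w : Sigma) : R :=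
  j`!%:R / l1 ^+ j *
  limn (series (fun m => weight l1 l2 w m.+1 * letter d1 d2 (w m.+1)
                         * 'C(ones w m.+1, j)%:R)).

Definition isCr (R : realType) (r : nat) (f : R -> R) : Prop :=
  (forall k, (k < r)%N -> forall x, derivable (derive1n k f) x 1) /\
  continuous (derive1n r f).

(* f has derivatives of order < r in a neighbourhood of x, and the (r-1)-st one
   is differentiable at x. *)
Definition derivable_upto (R : realType) (r : nat) (f : R -> R) (x : R) : Prop :=
  (forall k, (k.+1 < r)%N -> \forall y \near x, derivable (derive1n k f) y 1) /\
  (forall k, (k < r)%N -> derivable (derive1n k f) x 1).

(* Integrability for functions that are only meaningful almost everywhere: the
   sigma-algebra of Sigma is not complete. *)
Definition ae_integrable (d : measure_display) (T : measurableType d)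
    (R : realType) (mu : {measure set T -> \bar R}) (f : T -> R) : Prop :=
  exists2 g : T -> R, mu.-integrable setT (EFin \o g) &
    {ae mu, forall t, f t = g t}.

(* k j stands for k_{j+1}; the constraint forces k_j <= l, so k may be taken
   with values in 'I_l.+1. *)
Definition bell_index (l : nat) (k : {ffun 'I_l -> 'I_l.+1}) : bool :=
  (\sum_(j < l) j.+1 * k j == l)%N.

Definition bell_coef (R : realType) (l : nat) (k : {ffun 'I_l -> 'I_l.+1}) : R :=
  l`!%:R / \prod_(j < l) ((k j)`!%:R * j.+1`!%:R ^+ k j).

Definition faa_di_bruno (R : realType) (l1 l2 d1 d2 : R) (phi : R -> R)
    (l : nat) (w : Sigma) : R :=
  \sum_(k : {ffun 'I_l -> 'I_l.+1} | bell_index k)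
    bell_coef R k * derive1n (\sum_(j < l) k j)%N phi (X l1 l2 d1 d2 w)
    * \prod_(j < l) Xder l1 l2 d1 d2 j.+1 w ^+ k j.

(* Main.v *)
(* Write x = l1 + eps. Pick be > l1 and sg < 1 with (be^r + l2^r) / 2 < sg^r, and let W_m be
   the product lambda_(i_1) ... lambda_(i_m) for the parameters (be, l2). The random variable
   Z = sum_m (W_m / sg^m)^r has expectation sum_m ((be^r + l2^r) / (2 sg^r))^m < +oo, and
   Y = (1 + Z)^(1/r) satisfies W_m <= Y sg^m wherever Z is finite. The factor sg^m absorbs the
   polynomial factors produced by differentiation, so near l1 the function x |-> X is smooth
   and all of its derivatives are O(Y). Since phi^(k)(y) = O((1 + |y|)^(r - k)), the Faa di
   Bruno sum of any order l <= r is O(Y^r), which is integrable, and one may differentiate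
   r times under the integral sign.

   Faa di Bruno's formula is used as F_l = l! [t^l] sum_k phi^(k)(X) g^k / k!, where
   g = sum_(j >= 1) X^(j) t^j / j!. Since dg/dx = dg/dt - X^(1), the x-derivative of the
   generating function is its t-derivative, that is, dF_l/dx = F_(l+1).

   The stationary measure is the law of X: by stationarity, integrating f against mu is the same
   as integrating f at the image of a mu-distributed point under n independent random maps,
   and this image converges to X because W_m tends to 0. *)
From HB Require Import structures.
Require Import Defs.
From mathcomp Require Import all_boot all_order all_algebra.
From mathcomp Require Import all_classical all_reals all_analysis.
From mathcomp Require Import measurable_realfun.
From mathcomp Require Import ring lra zify.

Set Implicit Arguments.
Unset Strict Implicit.
Unset Printing Implicit Defensive.
Import Order.TTheory GRing.Theory Num.Theory.
Import numFieldNormedType.Exports.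

Local Open Scope classical_set_scope.
Local Open Scope ring_scope.

(** * Faa di Bruno's formula *)

(* The coefficient of t^n in (sum_j y_j t^j)^k: no truncation of the series is
   needed, so that powc can be differentiated in the y_j for all n at once. *)
Fixpoint powc (R : pzSemiRingType) (y : nat -> R) (k n : nat) : R :=
  if k is k'.+1 then \sum_(i < n.+1) powc y k' i * y (n - i)%N else (n == 0%N)%:R.

Lemma coef_exp_powc (R : comNzRingType) (y : nat -> R) (N k n : nat) :
  (n < N)%N -> ((\poly_(j < N) y j) ^+ k)`_n = powc y k n.
Proof.
elim: k n => [|k IH] n nN; first by rewrite expr0 coef1.
rewrite exprSr coefM/=; apply: eq_bigr => i _.
rewrite IH; last by case: i => i /=; lia.
by rewrite coef_poly; case: ifP => //; lia.
Qed.

Lemma powc_lt (R : pzSemiRingType) (y : nat -> R) (k n : nat) :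
  y 0%N = 0 -> (n < k)%N -> powc y k n = 0.
Proof.
move=> y0; elim: k n => // k IH n nk /=.
rewrite big_ord_recr/= subnn y0 mulr0 addr0 big1// => i _.
by rewrite IH ?mul0r//; case: i => i /=; lia.
Qed.

(* exp (s * sum_j z_j) = prod_j exp (s * z_j), compared at s^k. *)
Lemma coef_prod_exp (R : numFieldType) (M n : nat) (z : nat -> {poly R}) (k : nat) :
  (k < M)%N ->
  (\prod_(j < n) \poly_(i < M) (i`!%:R^-1 *: z j ^+ i))`_k =
    k`!%:R^-1 *: (\sum_(j < n) z j) ^+ k.
Proof.
elim: n k => [|n IH] k kM.
  rewrite !big_ord0 coef1; case: k kM => [|k] _.
    by rewrite expr0 fact0 invr1 scale1r.
  by rewrite exprS mul0r scaler0.
rewrite !big_ord_recr/= coefMr exprDn scaler_sumr; apply: eq_bigr => i _.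
have ik : (i <= k)%N by case: i => i /=; lia.
rewrite IH ?coef_poly; last lia.
rewrite ifT; last lia.
rewrite -scalerAl -scalerAr scalerA -[_ ^+ _ * _ ^+ _ *+ _]scaler_nat scalerA; congr (_ *: _).
rewrite -[in RHS](bin_fact ik) !natrM.
have h1 : (i`!)%:R != 0 :> R by rewrite pnatr_eq0; have := fact_gt0 i; lia.
have h2 : ((k - i)`!)%:R != 0 :> R by rewrite pnatr_eq0; have := fact_gt0 (k - i); lia.
have h3 : ('C(k, i))%:R != 0 :> R by rewrite pnatr_eq0; have := bin_gt0 k i; lia.
by field; rewrite h1 h2 h3.
Qed.

(** Here polynomials in s have coefficients that are polynomials in t. Expanding the product of
    truncated exponentials of [s * z j], a choice [f] of exponents contributes a multiple of s^(sum
    f_j) t^(sum (j+1) f_j); reading off s^k and then t^l produces the two constraints on [f]. *)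
Lemma coef_exp_multinomial (R : numFieldType) (l : nat) (y : nat -> R) (k : nat) :
  y 0%N = 0 -> (k <= l)%N ->
  k`!%:R^-1 * powc y k l =
    \sum_(f : {ffun 'I_l -> 'I_l.+1} | bell_index f && (\sum_(j < l) f j == k)%N)
      \prod_(j < l) ((f j)`!%:R^-1 * y j.+1 ^+ f j).
Proof.
move=> y0 kl.
pose z (j : nat) : {poly R} := y j.+1 *: 'X^(j.+1).
have -> : powc y k l = ((\sum_(j < l) z j) ^+ k)`_l.
  rewrite -(@coef_exp_powc _ _ l.+1)// poly_def big_ord_recl/= y0 scale0r add0r.
  by under eq_bigr do rewrite /bump/= add1n.
have := @coef_prod_exp R l.+1 l z k; rewrite ltnS => /(_ kl) /(congr1 (fun p : {poly R} => p`_l)).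
rewrite coefZ => <-.
under eq_bigr do rewrite poly_def.
rewrite bigA_distr_bigA/= coef_sum coef_sum big_mkcond/=.
rewrite [RHS]big_mkcond/=; apply: eq_bigr => f _.
rewrite (_ : \prod_(i < l) _ =
  (\prod_(i < l) ((f i)`!%:R^-1 *: z i ^+ f i)) *: 'X^(\sum_(i < l) f i)); last first.
  elim/big_rec3: _ => [|i a b c _ ->]; first by rewrite expr0 scale1r.
  by rewrite exprD -scalerAl -scalerAr scalerA.
rewrite coefZ coefXn.
rewrite (_ : \prod_(i < l) _ = (\prod_(i < l) ((f i)`!%:R^-1 * y i.+1 ^+ f i)) *:
  'X^(\sum_(i < l) i.+1 * f i)); last first.
  elim/big_rec3: _ => [|i a b c _ ->]; first by rewrite expr0 scale1r.
  rewrite exprD -!scalerAl -scalerAr scalerA /z exprZn -exprM scalerA -scalerAl scalerA.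
  by congr (_ *: _); exact: mulrAC.
rewrite /bell_index eq_sym; case: eqP => _; last by rewrite andbF mulr0 coef0.
by rewrite andbT mulr1 coefZ coefXn eq_sym; case: eqP; rewrite ?mulr1 ?mulr0.
Qed.

(** Grouping the indices by k, their total, makes the factor [a] constant on each group, and the
    multinomial formula sums the rest. The powers of j! in [bell_coef] are absorbed by dividing
    [Y j] by j!. *)
Lemma sum_bell_index (R : realType) (l : nat) (a Y : nat -> R) :
  \sum_(k : {ffun 'I_l -> 'I_l.+1} | bell_index k)
    bell_coef R k * a (\sum_(j < l) k j)%N * \prod_(j < l) Y j.+1 ^+ k j =
  l`!%:R * \sum_(k < l.+1) a k / k`!%:R *
     powc (fun j => if j is 0%N then 0 else Y j / j`!%:R) k l.
Proof.
set y := (fun j : nat => if j is 0 then _ else _).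
have -> : \sum_(k < l.+1) a k / k`!%:R * powc y k l =
  \sum_(k < l.+1) \sum_(f : {ffun 'I_l -> 'I_l.+1} | bell_index f && (\sum_(j < l) f j == k)%N)
      a (\sum_(j < l) f j)%N * \prod_(j < l) ((f j)`!%:R^-1 * y j.+1 ^+ f j).
  apply: eq_bigr => k _; rewrite -mulrA coef_exp_multinomial//; last by rewrite -ltnS.
  by rewrite mulr_sumr; apply: eq_bigr => f /andP[_ /eqP ->].
(* Every part has weight j+1 >= 1, so the number of parts is at most l and indexes a summand. *)
have s_le (f : {ffun 'I_l -> 'I_l.+1}) : bell_index f -> (\sum_(j < l) f j < l.+1)%N.
  move=> /eqP fl; rewrite ltnS -[leqRHS]fl; apply: leq_sum => j _; exact: leq_pmull.
rewrite (exchange_big_dep (fun f => bell_index f))/=; last by move=> k f _ /andP[].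
rewrite mulr_sumr; apply: eq_bigr => f bf.
rewrite bf/= (big_pred1 (Ordinal (s_le _ bf))); last first.
  by move=> k /=; rewrite eq_sym -val_eqE.
rewrite /bell_coef -!mulrA; congr (_ * _); rewrite mulrCA; congr (_ * _).
rewrite -prodfV -big_split/=; apply: eq_bigr => j _.
by rewrite exprMn exprVn invfM; ring.
Qed.

Lemma is_derive_sumE (R : realType) (n : nat) (h : 'I_n -> R -> R) (dh : 'I_n -> R) (x : R) :
  (forall i, is_derive x 1 (h i) (dh i)) ->
  is_derive x 1 (fun t => \sum_(i < n) h i t) (\sum_(i < n) dh i).
Proof.
move=> /is_derive_sum; rewrite (_ : \sum_(i < n) h i = fun t => \sum_(i < n) h i t)//.
by apply/funext => t; rewrite fct_sumE.
Qed.

(* With y_j = X_j / j! and X_j' = X_(j+1), the series g = sum_(j >= 1) y_j t^j satisfies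
   dg/dx = dg/dt - X_1, hence d(g^k)/dx = d(g^k)/dt - k X_1 g^(k-1). *)
Lemma is_derive_powc (R : realType) (y : nat -> R -> R) (x : R) (k n : nat) :
  (forall t, y 0%N t = 0) ->
  (forall j, is_derive x 1 (y j.+1) (j.+2%:R * y j.+2 x)) ->
  is_derive x 1 (fun t => powc (y ^~ t) k n)
    (n.+1%:R * powc (y ^~ x) k n.+1 - k%:R * y 1%N x * powc (y ^~ x) k.-1 n).
Proof.
move=> y0 dy; elim: k n => [|k IH] n.
  rewrite /= mulr0 !mul0r subr0; exact: is_derive_cst.
(* The correction at j = 0 makes one formula valid for all j: y_0' = 0 = y_1 - y_1. *)
have dy' j : is_derive x 1 (y j) (j.+1%:R * y j.+1 x - (j == 0%N)%:R * y 1%N x).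
  case: j => [|j]; last by rewrite mul0r subr0.
  rewrite mul1r subrr (_ : y 0%N = cst 0); last exact/funext.
  exact: is_derive_cst.
have := is_derive_sumE (fun i : 'I_n.+1 => is_deriveM (IH i) (dy' (n - i)%N)).
move/is_derive_eq; apply.
rewrite {IH dy dy'}.
set c := powc (y ^~ x) k; set c' := powc (y ^~ x) k.-1.
(* For k = 0 the truncated [k.-1] is harmless, being multiplied by k. *)
have E1 : k%:R * \sum_(i < n.+1) c' i * y (n - i)%N x = k%:R * c n.
  by case: k @c @c' => [|k] /=; rewrite ?mul0r.
(* Leibniz's rule in t: the two sums are the convolution for g^(k+1) at t^(n+1), weighted by n+1-i
   and by i, and these weights add up to n+1. *)
have E2 : \sum_(i < n.+1) c i * ((n - i).+1%:R * y (n - i).+1 x) +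
    \sum_(i < n.+1) y (n - i)%N x * (i.+1%:R * c i.+1) =
    n.+1%:R * \sum_(i < n.+2) c i * y (n.+1 - i)%N x.
  have -> : \sum_(i < n.+1) c i * ((n - i).+1%:R * y (n - i).+1 x) =
            \sum_(i < n.+2) (n.+1 - i)%:R * (c i * y (n.+1 - i)%N x).
    rewrite [RHS]big_ord_recr/= subnn mul0r addr0; apply: eq_bigr => i _.
    by rewrite subSn; [rewrite mulrCA|rewrite -ltnS].
  have -> : \sum_(i < n.+1) y (n - i)%N x * (i.+1%:R * c i.+1) =
            \sum_(i < n.+2) i%:R * (c i * y (n.+1 - i)%N x).
    rewrite [RHS]big_ord_recl/= mul0r add0r; apply: eq_bigr => i _.
    by rewrite /bump/= add1n subSS; ring.
  rewrite -big_split mulr_sumr; apply: eq_bigr => i _ /=.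
  by rewrite -mulrDl -natrD subnK// -ltnS.
rewrite -E2 /=.
transitivity (\sum_(i < n.+1) c i * ((n - i).+1%:R * y (n - i).+1 x) +
    \sum_(i < n.+1) y (n - i)%N x * (i.+1%:R * c i.+1)
  - y 1%N x * (\sum_(i < n.+1) c i * (n - i == 0)%N%:R)
  - y 1%N x * (k%:R * \sum_(i < n.+1) c' i * y (n - i)%N x)).
  rewrite !mulr_sumr -!sumrN -!big_split/=; apply: eq_bigr => i _.
  by rewrite /GRing.scale/= -/c -/c'; ring.
have -> : \sum_(i < n.+1) c i * (n - i == 0)%N%:R = c n.
  rewrite big_ord_recr/= subnn eqxx mulr1 big1 ?add0r// => i _.
  by rewrite subn_eq0 leqNgt ltn_ord mulr0.
by rewrite E1 -natr1; ring.
Qed.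

(** [X 0] is the point at which the derivatives of [phi] are taken and the later [X j] are its
    derivatives; the inner series therefore has no constant term. *)
Definition faa_sum (R : realType) (phi : R -> R) (X : nat -> R) (l : nat) : R :=
  l`!%:R * \sum_(k < l.+1) derive1n k phi (X 0%N) / k`!%:R *
     powc (fun j => if j is 0%N then 0 else X j / j`!%:R) k l.

(** Differentiating phi^(k)(X) produces phi^(k+1)(X) X_1 g^k / k!, which cancels the correction -X_1
    g^k / k! coming from the derivative of g^(k+1) / (k+1)!. Only t-derivatives remain, and they
    turn [t^l] into (l+1) [t^(l+1)]. *)
Lemma is_derive_faa_sum (R : realType) (phi : R -> R) (X : nat -> R -> R) (l : nat) (x : R) :
  (forall j, is_derive x 1 (X j) (X j.+1 x)) ->
  (forall k, (k <= l)%N -> derivable (derive1n k phi) (X 0%N x) 1) ->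
  is_derive x 1 (fun t => faa_sum phi (X ^~ t) l) (faa_sum phi (X ^~ x) l.+1).
Proof.
move=> dX dphi; rewrite /faa_sum.
pose y j t := if j is 0%N then 0 else X j t / j`!%:R.
have fact_neq0 j : j`!%:R != 0 :> R by rewrite pnatr_eq0 -lt0n fact_gt0.
have dy j : is_derive x 1 (y j.+1) (j.+2%:R * y j.+2 x).
  have := is_deriveM (dX j.+1) (is_derive_cst (j.+1`!%:R^-1 : R) x 1).
  move/is_derive_eq; apply.
  rewrite /y (factS j.+1) natrM scaler0 add0r /GRing.scale/=.
  by field; rewrite fact_neq0 -natrD pnatr_eq0.
pose p k := derive1n k phi (X 0%N x).
have pE k : derive1n k phi (X 0%N x) = p k by [].
have dp (k : 'I_l.+1) : is_derive x 1 (fun t => derive1n k phi (X 0%N t) / k`!%:R)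
    (p k.+1 * X 1%N x / k`!%:R).
  have h : is_derive (X 0%N x) 1 (derive1n k phi) (p k.+1).
    by rewrite /p derive1nS derive1E; apply: DeriveDef => //; apply: dphi; rewrite -ltnS.
  have := is_deriveM (is_derive1_comp h (dX 0%N)) (is_derive_cst (k`!%:R^-1 : R) x 1).
  by move/is_derive_eq; apply; rewrite scaler0 add0r; exact: mulrC.
have y0 t : y 0%N t = 0 by [].
have y1 : X 1%N x / 1`!%:R = X 1%N x by rewrite factS fact0 divr1.
have := is_deriveM (is_derive_cst (l`!%:R : R) x 1)
  (is_derive_sumE (fun k : 'I_l.+1 => is_deriveM (dp k) (is_derive_powc k l y0 dy))).
move/is_derive_eq; apply.
rewrite scaler0 addr0 factS natrM (mulrC l.+1%:R) -mulrA.
congr (_ * _).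
transitivity (l.+1%:R * \sum_(k < l.+2) p k / k`!%:R * powc (y ^~ x) k l.+1); last by [].
pose E k n := powc (y ^~ x) k n / k`!%:R.
transitivity (\sum_(k < l.+1) (p k * (l.+1%:R * E k l.+1) +
   (p k.+1 * X 1%N x * E k l - (if (k : nat) is 0%N then 0 else p k * X 1%N x * E k.-1 l)))).
  apply: eq_bigr => -[k kl] _ /=.
  rewrite !pE y1 /E /GRing.scale/=.
  case: k kl => [|k] kl/=; first by rewrite fact0 divr1; ring.
  rewrite factS natrM; field.
  by rewrite fact_neq0 nat1r pnatr_eq0.
rewrite big_split/= [in RHS]big_ord_recr mulrDr mulr_sumr; congr (_ + _).
  by apply: eq_bigr => i _; rewrite /E; ring.
rewrite -(big_mkord xpredT (fun k => p k.+1 * X 1%N x * E k l -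
   (if k is 0%N then 0 else p k * X 1%N x * E k.-1 l))).
(* The cancellation telescopes and leaves the upper end, which has to be the missing summand k = l+1
   of the target. *)
rewrite (telescope_sumr_eq (fun k => if k is 0%N then 0 else p k * X 1%N x * E k.-1 l))//.
rewrite [LHS]/=.
rewrite subr0 /E.
(* Since g starts at order t, the lowest coefficient of g^(l+1) is y_1 times that of g^l. *)
have -> : powc (y ^~ x) l.+1 l.+1 = powc (y ^~ x) l l * X 1%N x.
  rewrite /= 2!big_ord_recr/= subnn subSnn big1 ?add0r => [|i _]; last first.
    by rewrite powc_lt ?mul0r.
  by rewrite mulr0 addr0; congr (_ * _); exact: y1.
by rewrite factS natrM; field; rewrite fact_neq0 nat1r pnatr_eq0.
Qed.

(** The interval is open, so equality on it is equality near each of its points, and this survives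
    differentiation in the induction on k. *)
Lemma derive1n_chain (R : realType) (a b : R) (r : nat) (f : R -> R) (F : nat -> R -> R) :
  {in `]a, b[, f =1 F 0%N} ->
  (forall k, (k < r)%N -> {in `]a, b[, forall x : R, is_derive x 1 (F k) (F k.+1 x)}) ->
  forall k, (k <= r)%N -> {in `]a, b[, derive1n k f =1 F k}.
Proof.
move=> fF dF; elim=> [|k IH] kr x xab; first exact: fF.
rewrite derive1nS derive1E.
have kab := IH (ltnW kr).
have : \near x, F k x = derive1n k f x.
  by near=> z; rewrite kab//; near: z; exact: near_in_itvoo.
by move=> /near_eq_is_derive /(_ (dF _ kr _ xab)) [].
Unshelve. all: by end_near. Qed.

Lemma derivable_chain (R : realType) (a b : R) (r : nat) (f : R -> R) (F : nat -> R -> R) :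
  {in `]a, b[, f =1 F 0%N} ->
  (forall k, (k < r)%N -> {in `]a, b[, forall x : R, is_derive x 1 (F k) (F k.+1 x)}) ->
  forall k, (k < r)%N -> {in `]a, b[, forall x : R, derivable (derive1n k f) x 1}.
Proof.
move=> fF dF k kr x xab.
have : \near x, F k x = derive1n k f x.
  near=> z; rewrite (derive1n_chain fF dF)//; first exact: ltnW.
  by near: z; exact: near_in_itvoo.
by move=> /near_eq_is_derive /(_ (dF _ kr _ xab)) [].
Unshelve. all: by end_near. Qed.

Lemma derivable_upto_chain (R : realType) (a b x : R) (r : nat) (f : R -> R) (F : nat -> R -> R) :
  x \in `]a, b[ -> {in `]a, b[, f =1 F 0%N} ->
  (forall k, (k < r)%N -> {in `]a, b[, forall x : R, is_derive x 1 (F k) (F k.+1 x)}) ->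
  derivable_upto r f x.
Proof.
move=> xab fF dF; split=> k kr; last exact: (derivable_chain fF dF).
near=> z; apply: (derivable_chain fF dF); first exact: ltnW.
by near: z; exact: near_in_itvoo.
Unshelve. all: by end_near. Qed.

(** * Termwise differentiation *)

(** Induction on j: each factor m is absorbed by raising the rate from t to some t' < 1, because
    (t'/t)^m = (1 + c)^m >= m c by Bernoulli's inequality. *)
Lemma poly_mul_geometric (R : realType) (s : R) (j : nat) : 0 < s < 1 ->
  exists K t : R, [/\ 0 <= K, 0 < t < 1 & forall m, m%:R ^+ j * s ^+ m <= K * t ^+ m].
Proof.
move=> s01; elim: j => [|j [K [t [K0 /andP[t0 t1] H]]]].
  by exists 1, s; split => // m; rewrite expr0.
pose t' := (1 + t) / 2.
have tt' : t < t' by rewrite /t'; lra.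
have t'0 : 0 < t' by exact: lt_trans tt'.
pose c := t' / t - 1.
have c0 : 0 < c by rewrite subr_gt0 ltr_pdivlMr// mul1r.
have mt m : m%:R * t ^+ m <= c^-1 * t' ^+ m.
  have E : t' ^+ m = (1 + c) ^+ m * t ^+ m.
    by rewrite -exprMn /c addrC subrK divfK// gt_eqF.
  have cm : m%:R * c <= (1 + c) ^+ m.
    elim: m {E} => [|m IHm]; first by rewrite mul0r expr0.
    rewrite exprS -natr1.
    have h1 : 1 <= (1 + c) ^+ m by rewrite exprn_ege1// lerDl ltW.
    by nra.
  rewrite E mulrA ler_pM2r ?exprn_gt0//.
  by rewrite ler_pdivlMl// mulrC.
exists (K / c), t'; split.
- by rewrite divr_ge0// ltW.
- by rewrite t'0/= /t'; lra.
move=> m; rewrite exprS -mulrA.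
rewrite (le_trans (ler_wpM2l (ler0n _ m) (H m)))// mulrCA -mulrA.
exact: ler_wpM2l.
Qed.

Lemma cvg_series_le_geometric (R : realType) (u : nat -> R) (A t : R) :
  0 < t < 1 -> (forall m, `|u m| <= A * t ^+ m) -> cvgn (series u).
Proof.
move=> /andP[t0 t1] uA; apply: normed_cvg.
apply: (series_le_cvg _ _ uA) => [m|m|].
- exact: normr_ge0.
- exact: le_trans (uA m).
- by apply: is_cvg_geometric_series; rewrite gtr0_norm.
Qed.

Lemma norm_lim_series_le_geometric (R : realType) (u : nat -> R) (A t : R) :
  0 < t < 1 -> (forall m, `|u m| <= A * t ^+ m) ->
  `|limn (series u)| <= A / (1 - t).
Proof.
move=> t01 uA; have cu := cvg_series_le_geometric t01 uA.
have /andP[t0 t1] := t01.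
have cnu : cvgn (series (fun m => `|u m|)).
  by apply: (cvg_series_le_geometric t01 (A := A)) => m; rewrite normr_id.
have gt : cvgn (series (fun m => A * t ^+ m)).
  by apply: is_cvg_geometric_series; rewrite gtr0_norm.
apply: le_trans (lim_series_norm cnu) _.
apply: le_trans (lim_series_le cnu gt uA) _.
by rewrite (cvg_lim _ (@cvg_geometric_series _ A t _))// gtr0_norm.
Qed.

(** Induction on n, multiplying the remainder by y; the sum closes because n^2 + n <= (n+1)^2.
    Dividing by al^2 keeps the exponent n on be, so that no lowered exponent appears in the
    bound. *)
Lemma pow_taylor2 (R : realType) (al be x y : R) (n : nat) :
  0 < al -> al <= x <= be -> al <= y <= be ->
  `|y ^+ n - x ^+ n - n%:R * x ^+ n.-1 * (y - x)| <=
    n%:R ^+ 2 * (be ^+ n / al ^+ 2) * (y - x) ^+ 2.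
Proof.
move=> al0 /andP[ax xb] /andP[ay yb].
have x0 : 0 < x by exact: lt_le_trans ax.
have y0 : 0 < y by exact: lt_le_trans ay.
have be0 : 0 < be by exact: lt_le_trans xb.
elim: n => [|n IH]; first by rewrite !expr0 subrr !mul0r subr0 normr0 expr2 !mul0r.
have -> : y ^+ n.+1 - x ^+ n.+1 - n.+1%:R * x ^+ n.+1.-1 * (y - x) =
   y * (y ^+ n - x ^+ n - n%:R * x ^+ n.-1 * (y - x)) + n%:R * x ^+ n.-1 * (y - x) ^+ 2.
  case: n {IH} => [|n]; first by rewrite !expr0 !expr1 /=; ring.
  by rewrite /= !exprS -!natr1; ring.
set e := _ - _ - _ in IH *.
apply: le_trans (ler_normD _ _) _.
rewrite normrM (gtr0_norm y0).
have h1 : y * `|e| <= be * (n%:R ^+ 2 * (be ^+ n / al ^+ 2) * (y - x) ^+ 2).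
  by apply: ler_pM => //; exact: ltW.
have h2 : `|n%:R * x ^+ n.-1 * (y - x) ^+ 2| <=
    n%:R * (be ^+ n.+1 / al ^+ 2) * (y - x) ^+ 2.
  rewrite ger0_norm; last first.
    by rewrite mulr_ge0 ?exprn_even_ge0// mulr_ge0// exprn_ge0// ltW.
  apply: ler_wpM2r; first by rewrite exprn_even_ge0.
  case: n {IH e h1} => [|n]; first by rewrite !mul0r.
  apply: ler_wpM2l => //=.
  rewrite ler_pdivlMr ?exprn_gt0// -[n.+2]addn2 exprD.
  have [x0' al0' be0'] : [/\ 0 <= x, 0 <= al & 0 <= be] by split; exact: ltW.
  by apply: ler_pM; rewrite ?exprn_ge0// lerXn2r// (le_trans ax).
apply: le_trans (lerD h1 h2) _.
rewrite -natr1 (exprS be).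
set p := be ^+ n / al ^+ 2 in h1 *; set d := (y - x) ^+ 2.
have -> : be * be ^+ n / al ^+ 2 = be * p by rewrite mulrA.
have bpd : 0 <= be * p * d.
  apply: mulr_ge0; last by rewrite exprn_even_ge0.
  by rewrite mulr_ge0 ?divr_ge0 ?exprn_ge0// ltW.
have : 0 <= (n%:R : R) by [].
by nra.
Qed.

(** The error of the difference quotient with increment h is at most C |h|. *)
Lemma is_derive_quadratic (R : realType) (f : R -> R) (a b x l C : R) :
  x \in `]a, b[ ->
  {in `]a, b[, forall y : R, `|f y - f x - l * (y - x)| <= C * (y - x) ^+ 2} ->
  is_derive x 1 f l.
Proof.
move=> xab H.
have H' : h^-1 *: (f (h *: 1 + x) - f x) @[h --> 0^'] --> l.
  apply/cvgrPdist_le => e e0.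
  have xab' : 0 < Num.min (x - a) (b - x).
    by move: xab; rewrite in_itv/= lt_min !subr_gt0.
  have eC : 0 < e / (`|C| + 1) by rewrite divr_gt0// ltr_wpDl.
  near=> h.
  have h0 : h != 0 by near: h; exact: nbhs_dnbhs_neq.
  rewrite scaler1 distrC.
  have hab : h + x \in `]a, b[.
    have : `|h| < Num.min (x - a) (b - x) by near: h; exact: dnbhs0_lt.
    by rewrite lt_min !ltr_norml in_itv/= => /andP[/andP[? ?] /andP[? ?]]; lra.
  have hC : `|h| <= e / (`|C| + 1) by near: h; exact: dnbhs0_le.
  have := H _ hab; rewrite addrK => {}H.
  have -> : h^-1 *: (f (h + x) - f x) - l = h^-1 * (f (h + x) - f x - l * h).
    by rewrite /GRing.scale/= [RHS]mulrBr mulrCA mulVf ?mulr1.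
  rewrite normrM normfV ler_pdivrMl ?normr_gt0//.
  apply: le_trans H _.
  have h2 : h ^+ 2 = `|h| * `|h| by rewrite -expr2 real_normK ?num_real.
  rewrite h2 mulrCA ler_wpM2l//.
  apply: (@le_trans _ _ (`|C| * `|h|)); first by rewrite ler_wpM2r ?ler_norm.
  move: hC; rewrite ler_pdivlMr ?ltr_wpDl//; have := normr_ge0 h; lra.
apply: DeriveDef; first by apply/cvg_ex; exists l.
exact: cvg_lim.
Unshelve. all: by end_near. Qed.

(* Terms of the j-th derivative of sum_m c_m x^(o m); the truncated exponent o m - j
   is harmless, because the falling factorial vanishes when o m < j. *)
Definition monoser (R : realType) (c : nat -> R) (o : nat -> nat) (j : nat) (x : R) :
    nat -> R :=
  fun m => c m * ((o m ^_ j)%:R * x ^+ (o m - j)).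

Lemma falling_monomial_le (R : realType) (al be x : R) (n j : nat) :
  0 < al -> al <= x <= be ->
  (n ^_ j)%:R * x ^+ (n - j) <= n%:R ^+ j * (be ^+ n / al ^+ j).
Proof.
move=> al0 /andP[ax xb].
have x0 : 0 < x by exact: lt_le_trans ax.
have be0 : 0 < be by exact: lt_le_trans xb.
have [nj|jn] := ltnP n j.
  rewrite ffact_small// mul0r mulr_ge0 ?exprn_ge0// divr_ge0// exprn_ge0//; exact: ltW.
apply: ler_pM => //.
- by rewrite exprn_ge0// ltW.
- rewrite -natrX ler_nat.
  elim: j {jn} => [|j IH]; first by rewrite ffactn0.
  by rewrite ffactnSr expnSr leq_mul// leq_subr.
rewrite ler_pdivlMr ?exprn_gt0// -[in leRHS](subnK jn) exprD.
have [x0' al0' be0'] : [/\ 0 <= x, 0 <= al & 0 <= be] by split; exact: ltW.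
by apply: ler_pM; rewrite ?exprn_ge0// lerXn2r// (le_trans ax).
Qed.

(** The order of the quantifiers is the point: K is fixed before c, o, B and x, so one constant
    serves all random sequences and B can carry the random majorant. *)
Lemma monoser_bound (R : realType) (al be sg : R) (j : nat) :
  0 < al -> 0 < sg < 1 ->
  exists2 K : R, 0 <= K & forall (c : nat -> R) (o : nat -> nat) (B x : R),
    0 <= B -> (forall m, (o m <= m)%N) ->
    (forall m, `|c m| * be ^+ o m <= B * sg ^+ m) -> al <= x <= be ->
    cvgn (series (monoser c o j x)) /\ `|limn (series (monoser c o j x))| <= K * B.
Proof.
move=> al0 sg01; have [K [t [K0 t01 H]]] := poly_mul_geometric j sg01.
have /andP[t0 t1] := t01.
exists (K / al ^+ j / (1 - t)).
  by rewrite divr_ge0 ?subr_ge0 ?(ltW t1)// divr_ge0// exprn_ge0// ltW.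
move=> c o B x B0 om cB xab.
have x0 : 0 < x by case/andP: xab => ax _; exact: lt_le_trans ax.
have T m : `|monoser c o j x m| <= (B * (K / al ^+ j)) * t ^+ m.
  rewrite /monoser normrM (ger0_norm (_ : 0 <= _ * _)); last first.
    by rewrite mulr_ge0// exprn_ge0// ltW.
  apply: le_trans (ler_wpM2l (normr_ge0 _) (falling_monomial_le (o m) j al0 xab)) _.
  apply: (@le_trans _ _ (m%:R ^+ j * (`|c m| * be ^+ o m) / al ^+ j)).
    rewrite mulrCA -[leRHS]mulrA -[_ * _ / _]mulrA.
    apply: ler_wpM2r.
      rewrite mulr_ge0// divr_ge0 ?exprn_ge0// ltW//.
      by case/andP: xab => _; exact: lt_le_trans.
    by rewrite lerXn2r// ?nnegrE// ler_nat.
  apply: (@le_trans _ _ (m%:R ^+ j * (B * sg ^+ m) / al ^+ j)).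
    by rewrite ler_wpM2r ?invr_ge0 ?exprn_ge0 ?(ltW al0)// ler_wpM2l// exprn_ge0.
  have -> : m%:R ^+ j * (B * sg ^+ m) / al ^+ j = B / al ^+ j * (m%:R ^+ j * sg ^+ m) by ring.
  have -> : B * (K / al ^+ j) * t ^+ m = B / al ^+ j * (K * t ^+ m) by ring.
  by rewrite ler_wpM2l// divr_ge0// exprn_ge0// ltW.
split; first exact: cvg_series_le_geometric t01 T.
by apply: le_trans (norm_lim_series_le_geometric t01 T) _; rewrite -mulrA mulrC.
Qed.

(** The second-order Taylor remainders of the monomials are summed; the total is still quadratic in
    y - x because sg^m absorbs the powers of m. *)
Lemma is_derive_monoser (R : realType) (al be sg B x : R) (c : nat -> R) (o : nat -> nat)
    (j : nat) :
  0 < al -> 0 < sg < 1 -> 0 <= B -> (forall m, (o m <= m)%N) ->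
  (forall m, `|c m| * be ^+ o m <= B * sg ^+ m) -> x \in `]al, be[ ->
  is_derive x 1 (fun t => limn (series (monoser c o j t)))
                (limn (series (monoser c o j.+1 x))).
Proof.
move=> al0 sg01 B0 om cB xab.
have cvgj i y : al <= y <= be -> cvgn (series (monoser c o i y)).
  by have [K _ H] := monoser_bound be i al0 sg01; move=> /(H c o B y B0 om cB)[].
(* Of the power j+2 of m, j comes from the falling factorial and 2 from the Taylor remainder. *)
have [K [t [K0 t01 H]]] := poly_mul_geometric j.+2 sg01.
have in_cc (y : R) : y \in `]al, be[ -> al <= y <= be.
  by rewrite in_itv/= => /andP[/ltW-> /ltW->].
apply: (@is_derive_quadratic _ _ al be _ _ (B * (K / al ^+ j.+2) / (1 - t))) => // y yab.
have xcc := in_cc _ xab; have ycc := in_cc _ yab.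
set u := fun m => monoser c o j y m - monoser c o j x m - monoser c o j.+1 x m * (y - x).
have -> : limn (series (monoser c o j y)) - limn (series (monoser c o j x)) -
    limn (series (monoser c o j.+1 x)) * (y - x) = limn (series u).
  have -> : series u = (fun n => series (monoser c o j y) n - series (monoser c o j x) n -
    series (monoser c o j.+1 x) n * (y - x)).
    by apply/funext => n; rewrite /series/= mulr_suml -!sumrN -!big_split.
  apply/esym/cvg_lim => //.
  by apply: cvgB; [apply: cvgB|apply: cvgMl]; exact: cvgj.
suff T m : `|u m| <= B * (K / al ^+ j.+2) * (y - x) ^+ 2 * t ^+ m.
  by apply: le_trans (norm_lim_series_le_geometric t01 T) _; rewrite mulrAC.
rewrite /u /monoser.
have [oj|jo] := ltnP (o m) j.
  rewrite !ffact_small ?(ltnW oj)//; last exact: leqW.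
  rewrite !(mul0r, mulr0) !subr0 normr0.
  case/andP: t01 => t0 _; rewrite mulr_ge0 ?exprn_ge0 ?(ltW t0)//.
  by rewrite mulr_ge0 ?exprn_even_ge0// mulr_ge0// divr_ge0// exprn_ge0// ltW.
(* As n^_(j+1) = n^_j (n - j), the term is a multiple of the Taylor remainder of x^(o m - j). *)
have -> : c m * ((o m ^_ j)%:R * y ^+ (o m - j)) - c m * ((o m ^_ j)%:R * x ^+ (o m - j)) -
    c m * ((o m ^_ j.+1)%:R * x ^+ (o m - j.+1)) * (y - x) =
    c m * (o m ^_ j)%:R * (y ^+ (o m - j) - x ^+ (o m - j) -
                          (o m - j)%:R * x ^+ (o m - j).-1 * (y - x)).
  by rewrite ffactnSr natrM subnS; ring.
set n := (o m - j)%N; set d := (y - x) ^+ 2.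
have d0 : 0 <= d by rewrite exprn_even_ge0.
have be0 : 0 < be by case/andP: xcc => ax /(le_trans ax); exact: lt_le_trans.
rewrite normrM normrM (ger0_norm (ler0n _ _)).
apply: le_trans (ler_wpM2l _ (pow_taylor2 n al0 xcc ycc)) _; first exact: mulr_ge0.
rewrite -/d.
have bcc : al <= be <= be by rewrite lexx andbT; case/andP: xcc; exact: le_trans.
have F := falling_monomial_le (o m) j al0 bcc.
have nm : n%:R <= m%:R :> R by rewrite ler_nat (leq_trans (leq_subr _ _)).
apply: (@le_trans _ _ (`|c m| * (m%:R ^+ 2 * (m%:R ^+ j * (be ^+ o m / al ^+ j))) / al ^+ 2 * d)).
  have -> : `|c m| * (o m ^_ j)%:R * (n%:R ^+ 2 * (be ^+ n / al ^+ 2) * d) =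
    `|c m| * (n%:R ^+ 2 * ((o m ^_ j)%:R * be ^+ n)) / al ^+ 2 * d by ring.
  rewrite ler_wpM2r// ler_wpM2r ?invr_ge0 ?exprn_ge0 ?(ltW al0)// ler_wpM2l//.
  apply: ler_pM; rewrite ?exprn_ge0//.
  - by rewrite mulr_ge0// exprn_ge0// ltW.
  - by rewrite lerXn2r ?nnegrE.
  apply: (le_trans F); apply: ler_wpM2r.
    by rewrite divr_ge0// exprn_ge0// ltW.
  by rewrite lerXn2r// ?nnegrE// ler_nat.
have -> : `|c m| * (m%:R ^+ 2 * (m%:R ^+ j * (be ^+ o m / al ^+ j))) / al ^+ 2 * d =
  (m%:R ^+ j.+2 / al ^+ j.+2 * d) * (`|c m| * be ^+ o m).
  rewrite -[j.+2]addn2 !exprD (invfM (al ^+ j)); ring.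
have p0 : 0 <= m%:R ^+ j.+2 / al ^+ j.+2 * d.
  by rewrite mulr_ge0// divr_ge0 ?exprn_ge0// ltW.
apply: le_trans (ler_wpM2l p0 (cB m)) _.
have -> : m%:R ^+ j.+2 / al ^+ j.+2 * d * (B * sg ^+ m) =
  (B / al ^+ j.+2 * d) * (m%:R ^+ j.+2 * sg ^+ m) by ring.
have -> : B * (K / al ^+ j.+2) * d * t ^+ m = (B / al ^+ j.+2 * d) * (K * t ^+ m) by ring.
by rewrite ler_wpM2l// mulr_ge0// divr_ge0// exprn_ge0// ltW.
Qed.

(** * The Bernoulli measure *)

(** The hypothesis on [m] covers both the invariance of the Bernoulli measure under prepending a
    random letter and the stationarity of a measure on the line. *)
Lemma ge0_integral_half_mixture (R : realType) (d d' : measure_display)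
    (T : measurableType d) (T' : measurableType d')
    (m : {measure set T -> \bar R}) (m' : probability T' R)
    (g1 g2 : T' -> T) (f : T -> \bar R) :
  measurable_fun setT g1 -> measurable_fun setT g2 ->
  (forall A, measurable A ->
    m A = ((2^-1)%:E * pushforward m' g1 A + (2^-1)%:E * pushforward m' g2 A)%E) ->
  measurable_fun setT f -> (forall x, (0 <= f x)%E) ->
  (\int[m]_x f x = (2^-1)%:E * \int[m']_x f (g1 x) + (2^-1)%:E * \int[m']_x f (g2 x))%E.
Proof.
move=> mg1 mg2 mE mf f0.
pose G1 : {mfun T' >-> T} := HB.pack g1 (isMeasurableFun.Build _ _ _ _ g1 mg1).
pose G2 : {mfun T' >-> T} := HB.pack g2 (isMeasurableFun.Build _ _ _ _ g2 mg2).
have h0 : 0 <= 2^-1 :> R by rewrite invr_ge0.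
pose half : {nonneg R} := NngNum h0.
pose m1 : {measure set T -> \bar R} := mscale half (distribution m' G1).
pose m2 : {measure set T -> \bar R} := mscale half (distribution m' G2).
rewrite (eq_measure_integral (measure_add m1 m2)); last first.
  move=> A mA _; transitivity (m1 A + m2 A)%E; first exact: mE.
  by rewrite -measure_addE.
rewrite ge0_integral_measure_add//.
by rewrite !ge0_integral_mscale// !ge0_integral_pushforward.
Qed.

Definition scons (s : bool) (w : Sigma) : Sigma := fun n => if n is k.+1 then w k else s.

Lemma measurable_cylinder (w : nat -> bool) (n : nat) : measurable (cylinder w n : set Sigma).
Proof. by apply: sub_sigma_algebra; exists w, n. Qed.

Lemma scons_cylinder0 (s : bool) (w : nat -> bool) : scons s @^-1` cylinder w 0 = setT.
Proof. exact/seteqP. Qed.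

Lemma scons_cylinderS (s : bool) (w : nat -> bool) (n : nat) :
  scons s @^-1` cylinder w n.+1 = if s == w 0%N then cylinder (w \o S) n else set0.
Proof.
case: ifPn => sw; apply/seteqP; split => x //=.
- by move=> H i ni; exact: (H i.+1).
- by move=> H [|i] ni; [exact/eqP|exact: H].
by move=> /(_ 0%N isT)/= /eqP; exact/negP.
Qed.

Lemma measurable_scons (s : bool) : measurable_fun setT (scons s).
Proof.
apply: (@measurability _ _ _ Sigma _ _ (cylinders : set (set Sigma))) => //.
move=> _ [_ [w [[|n] ->]] <-]; rewrite setTI.
  by rewrite scons_cylinder0.
by rewrite scons_cylinderS; case: ifP => // _; exact: measurable_cylinder.
Qed.

(** Both sides are finite measures that agree on cylinders, which generate the sigma-algebra. *)
Lemma bernoulli_scons (R : realType) (A : set Sigma) : measurable A ->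
  bernoulli_nu R A =
    ((2^-1)%:E * pushforward (bernoulli_nu R) (scons true) A
   + (2^-1)%:E * pushforward (bernoulli_nu R) (scons false) A)%E.
Proof.
move=> mA; set nu := bernoulli_nu R; have nuP : is_bernoulli nu := bernoulliP R.
pose G1 s : {mfun Sigma >-> Sigma} :=
  HB.pack (scons s) (isMeasurableFun.Build _ _ _ _ (scons s) (measurable_scons s)).
have h0 : 0 <= 2^-1 :> R by rewrite invr_ge0.
pose half : {nonneg R} := NngNum h0.
pose m s : {measure set Sigma -> \bar R} := mscale half (distribution nu (G1 s)).
pose M : {measure set Sigma -> \bar R} := measure_add (m true) (m false).
have ME B : M B = (m true B + m false B)%E by rewrite -measure_addE.
suff : nu A = M A by rewrite ME.
pose w0 : nat -> bool := fun=> true.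
(* Disjoint cylinders exist, so the empty set is added to obtain a family closed under
   intersection. *)
apply: (@measure_unique _ R Sigma (cylinders `|` [set set0]) (fun=> cylinder w0 0)
  _ _ _ _ nu M) => //.
- change (<<s (cylinders : set (set Sigma)) >> = <<s cylinders `|` [set set0] >>).
  apply/seteqP; split; first by apply: sub_sigma_algebra2; exact: subsetUl.
  apply: smallest_sub; first exact: smallest_sigma_algebra.
  by move=> _ [[w [n ->]]|->]; [exact: measurable_cylinder|exact: (@measurable0 _ Sigma)].
- move=> A1 A2 [[w [n ->]]|->]; last by rewrite set0I; right.
  case=> [[w' [n' ->]]|->]; last by rewrite setI0; right.
  (* If the two cylinders share a point x, they intersect in the cylinder of x of the larger
     length. *)
  have [[x [xw xw']]|H] := pselect (exists x, (cylinder w n `&` cylinder w' n') x).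
    left; exists x, (maxn n n'); apply/seteqP; split => y /=.
      move=> [yw yw'] i; rewrite leq_max => /orP[] ni.
        by rewrite yw// xw.
      by rewrite yw'// xw'.
    move=> yx; split=> i ni; rewrite yx ?leq_max ?ni ?orbT//; [exact: xw|exact: xw'].
  by right; apply/seteqP; split => // x Hx; exfalso; apply: H; exists x.
- by move=> i; left; exists w0, 0%N.
- by apply/seteqP; split => // x _; exists 0%N.
- move=> B [[w [n ->]]|->]; last by rewrite !measure0.
  rewrite ME.
  change (nu (cylinder w n) = (2^-1)%:E * nu (scons true @^-1` cylinder w n) +
                              (2^-1)%:E * nu (scons false @^-1` cylinder w n))%E.
  case: n => [|n].
    rewrite !scons_cylinder0 !probability_setT nuP expr0 !mule1 -EFinD.
    by congr EFin; lra.
  rewrite !scons_cylinderS; case: (w 0%N) => /=; rewrite !nuP measure0 mule0.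
    by rewrite adde0 -EFinM exprS.
  by rewrite add0e -EFinM exprS.
- move=> _; apply: le_lt_trans (probability_le1 _ _) (ltry _).
  exact: measurable_cylinder.
Qed.

(** The preimage of any set is a union of cylinders, indexed by the finitely many words of length
    n. *)
Lemma measurable_fun_prefix (d : measure_display) (T : measurableType d)
    (f : Sigma -> T) (n : nat) :
  (forall w w' : Sigma, (forall i, (i < n)%N -> w i = w' i) -> f w = f w') ->
  measurable_fun setT f.
Proof.
move=> fE _ A mA; rewrite setTI.
pose ext (t : n.-tuple bool) : nat -> bool := nth false t.
have -> : f @^-1` A = \bigcup_(t : n.-tuple bool)
    (if `[< A (f (ext t)) >] then cylinder (ext t) n else set0).
  apply/seteqP; split => w /=.
    move=> Afw; pose t := [tuple w (i : nat) | i < n]; exists t => //.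
    have tw i : (i < n)%N -> ext t i = w i.
      by move=> ni; rewrite /ext -(tnth_nth _ t (Ordinal ni)) tnth_mktuple.
    by rewrite asboolT => [i ni|]; [rewrite tw|rewrite (fE _ w)].
  by move=> [t _]; case: asboolP => // At wt; rewrite /preimage/= (fE _ (ext t)).
apply: countable_bigcupT_measurable => [|t]; first exact: countableP.
by case: ifP => // _; exact: measurable_cylinder.
Qed.

(** Cauchy's criterion with tolerances 1/(k+1) uses only countable unions and intersections. *)
Lemma measurable_cvgn (R : realType) (d : measure_display) (T : measurableType d)
    (u : nat -> T -> R) :
  (forall n, measurable_fun setT (u n)) -> measurable [set x | cvgn (u ^~ x)].
Proof.
move=> mu.
have -> : [set x | cvgn (u ^~ x)] = \bigcap_k \bigcup_N \bigcap_n
    [set x | `|u (N + n)%N x - u N x| <= k.+1%:R^-1].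
  apply/seteqP; split => x /=.
    move=> /cauchy_cvgP /cauchyP cu k _.
    have [|y [N _ Ny]] := cu (k.+1%:R^-1 / 2); first by rewrite divr_gt0// invr_gt0.
    exists N => // n _ /=.
    have := Ny N (leqnn N); have := Ny (N + n)%N (leq_addr _ _).
    rewrite /= /ball/= (distrC y (u N x)) => h1 h2.
    have -> : u (N + n)%N x - u N x = - (y - u (N + n)%N x) - (u N x - y) by ring.
    by rewrite (le_trans (ler_normB _ _))// normrN (le_trans (ltW (ltrD h1 h2)))// -splitr.
  move=> H; apply/cauchy_cvgP; apply: cauchy_exP => e e0.
  have [k _ /(_ k (leqnn k)) /= ke] := near_infty_natSinv_lt (PosNum e0).
  have [N _ HN] := H k I.
  exists (u N x); exists N => // m /= Nm.
  rewrite /ball/= distrC (le_lt_trans _ ke)//.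
  by have := HN (m - N)%N I; rewrite subnKC.
apply: bigcap_measurableType => k _; apply: bigcup_measurable => N _.
apply: bigcap_measurableType => n _.
have mf : measurable_fun setT (fun x => `|u (N + n)%N x - u N x|).
  by apply: measurableT_comp => //; exact: measurable_funB.
have := mf measurableT _ (measurable_itv `]-oo, k.+1%:R^-1]).
by rewrite setTI; congr measurable; apply/seteqP; split => x /=; rewrite in_itv.
Qed.

(* No convergence is assumed: limn is the constant point where the sequence diverges. *)
Lemma measurable_limn (R : realType) (d : measure_display) (T : measurableType d)
    (u : nat -> T -> R) :
  (forall n, measurable_fun setT (u n)) -> measurable_fun setT (fun x => limn (u ^~ x)).
Proof.
move=> mu; have mE := measurable_cvgn mu; set E := [set _ | _] in mE.
rewrite -(setUv E); apply/measurable_funU => //; first exact: measurableC.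
split.
  apply: (@measurable_fun_cvg _ _ _ _ u) => // n; exact: measurable_funTS.
apply: (eq_measurable_fun (fun=> point)) => [x|]; last exact: measurable_cst.
by rewrite inE => Ex; rewrite dvgP.
Qed.

Lemma weight_scons (R : realType) (l1 l2 : R) (s : bool) (w : Sigma) (m : nat) :
  weight l1 l2 (scons s w) m.+1 = letter l1 l2 s * weight l1 l2 w m.
Proof.
by rewrite /weight big_ord_recl/=; congr (_ * _); apply: eq_bigr => i _; rewrite /bump add1n.
Qed.

Lemma weight_prefix (R : realType) (l1 l2 : R) (m : nat) (w w' : Sigma) :
  (forall i, (i < m)%N -> w i = w' i) -> weight l1 l2 w m = weight l1 l2 w' m.
Proof. by move=> ww; apply: eq_bigr => i _; rewrite ww. Qed.

Lemma weight_ge0 (R : realType) (l1 l2 : R) (m : nat) (w : Sigma) :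
  0 <= l1 -> 0 <= l2 -> 0 <= weight l1 l2 w m.
Proof. by move=> l10 l20; apply: prodr_ge0 => i _; case: (w i). Qed.

Lemma measurable_weight (R : realType) (l1 l2 : R) (m : nat) :
  measurable_fun setT (fun w => weight l1 l2 w m).
Proof. by apply: (@measurable_fun_prefix _ _ _ m) => w w'; exact: weight_prefix. Qed.

(** Conditioning on the first letter multiplies the r-th moment by the mean of l1^r and l2^r. *)
Lemma integral_weight_exp (R : realType) (l1 l2 : R) (r m : nat) : 0 <= l1 -> 0 <= l2 ->
  (\int[bernoulli_nu R]_w (weight l1 l2 w m ^+ r)%:E =
   (((l1 ^+ r + l2 ^+ r) / 2) ^+ m)%:E)%E.
Proof.
move=> l10 l20; elim: m => [|m IH].
  under eq_integral do rewrite /weight big_ord0 expr1n.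
  by rewrite integral_cst// mul1e expr0; exact: probability_setT.
have mw k : measurable_fun setT (fun w => (weight l1 l2 w k ^+ r)%:E).
  by apply/measurable_EFinP; apply: measurable_funX; exact: measurable_weight.
have w0 k w : (0 <= (weight l1 l2 w k ^+ r)%:E)%E.
  by rewrite lee_fin exprn_ge0// weight_ge0.
rewrite (ge0_integral_half_mixture (measurable_scons true) (measurable_scons false)
  (@bernoulli_scons R))//.
have E s : (\int[bernoulli_nu R]_x (weight l1 l2 (scons s x) m.+1 ^+ r)%:E =
    (letter l1 l2 s ^+ r * ((l1 ^+ r + l2 ^+ r) / 2) ^+ m)%:E)%E.
  under eq_integral do rewrite weight_scons exprMn EFinM.
  have s0 : 0 <= letter l1 l2 s by case: s.
  by rewrite ge0_integralZl//= ?IH ?EFinM// lee_fin exprn_ge0.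
by rewrite !E -!EFinM -EFinD exprS; congr EFin; rewrite /=; ring.
Qed.

(** * The random variables Z and Y of the domination argument *)

Definition wsum (R : realType) (r : nat) (be l2 sg : R) (w : Sigma) : \bar R :=
  (\sum_(m <oo) ((weight be l2 w m / sg ^+ m) ^+ r)%:E)%E.

Definition good (R : realType) (r : nat) (be l2 sg : R) : set Sigma :=
  [set w | wsum r be l2 sg w \is a fin_num].

(** [fine] sends +oo to 0, so this is a real number at least 1 everywhere, but it controls the
    weights only on [good]. *)
Definition majorant (R : realType) (r : nat) (be l2 sg : R) (w : Sigma) : R :=
  (1 + fine (wsum r be l2 sg w)) `^ r%:R^-1.

Section majorant_lemmas.
Context {R : realType} (r : nat) (be l2 sg : R).
Hypotheses (r_gt0 : (0 < r)%N) (be_gt0 : 0 < be) (l2_gt0 : 0 < l2) (sg_gt0 : 0 < sg)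
  (q_lt : (be ^+ r + l2 ^+ r) / 2 < sg ^+ r).

Let term m w : \bar R := ((weight be l2 w m / sg ^+ m) ^+ r)%:E.

Let term_ge0 m w : (0 <= term m w)%E.
Proof.
by rewrite lee_fin exprn_ge0// divr_ge0 ?weight_ge0 ?exprn_ge0// ltW.
Qed.

Let measurable_term m : measurable_fun setT (term m).
Proof.
apply/measurable_EFinP; apply: measurable_funX; apply: measurable_funM => //.
exact: measurable_weight.
Qed.

Let wsum_ge0 w : (0 <= wsum r be l2 sg w)%E.
Proof. by apply: nneseries_ge0 => m _ _; exact: term_ge0. Qed.

Lemma measurable_wsum : measurable_fun setT (wsum r be l2 sg).
Proof.
by apply: (@ge0_emeasurable_sum _ _ _ setT term xpredT) => // *; exact: term_ge0.
Qed.

Lemma integral_wsum_lt_pinfty : (\int[bernoulli_nu R]_w wsum r be l2 sg w < +oo)%E.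
Proof.
rewrite integral_nneseries//; last by move=> *; exact: term_ge0.
pose t := (be ^+ r + l2 ^+ r) / 2 / sg ^+ r.
have t0 : 0 <= t by rewrite !divr_ge0 ?addr_ge0 ?exprn_ge0// ltW.
have t1 : t < 1 by rewrite ltr_pdivrMr ?exprn_gt0// mul1r.
have E m : (\int[bernoulli_nu R]_w term m w = (t ^+ m)%:E)%E.
  under eq_integral do rewrite /term exprMn mulrC EFinM.
  rewrite ge0_integralZl//.
  - by rewrite integral_weight_exp ?ltW// -EFinM /t [in RHS]exprMn mulrC !exprVn -!exprM mulnC.
  - apply/measurable_EFinP; apply: measurable_funX; exact: measurable_weight.
  - by move=> w _; rewrite lee_fin exprn_ge0// weight_ge0// ltW.
  - by rewrite lee_fin exprn_ge0// invr_ge0 exprn_ge0// ltW.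
apply: (@le_lt_trans _ _ ((1 - t)^-1)%:E); last exact: ltry.
apply: lime_le.
  by apply: is_cvg_nneseries => m _ _; apply: integral_ge0 => w _; exact: term_ge0.
apply: nearW => n.
under eq_bigr do rewrite E.
rewrite sumEFin lee_fin.
have := geometric_seriesE 1 (negbT (lt_eqF t1)).
move=> /(congr1 (@^~ n)); rewrite /series/=.
under eq_bigr do rewrite mul1r.
move=> ->; rewrite mul1r ler_pdivrMr ?subr_gt0// mulVf ?subr_eq0 ?gt_eqF//.
by rewrite gerBl exprn_ge0.
Qed.

Lemma integrable_wsum : (bernoulli_nu R).-integrable setT (wsum r be l2 sg).
Proof.
apply/integrableP; split; first exact: measurable_wsum.
by under eq_integral do rewrite gee0_abs//; exact: integral_wsum_lt_pinfty.
Qed.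

Lemma measurable_good : measurable (good r be l2 sg).
Proof.
have := emeasurable_fin_num measurableT measurable_wsum.
by rewrite setTI.
Qed.

Lemma good_ae : bernoulli_nu R (~` good r be l2 sg) = 0%E.
Proof.
have [N [mN N0 sN]] := integrable_ae measurableT integrable_wsum.
apply: (subset_measure0 _ mN _ N0); first exact: measurableC measurable_good.
by move=> w Gw; apply: sN => /= H; apply: Gw; exact: H.
Qed.

Lemma majorant_ge1 w : 1 <= majorant r be l2 sg w.
Proof.
have -> : 1 = (1 : R) `^ r%:R^-1 by rewrite powR1.
rewrite ge0_ler_powR ?nnegrE ?invr_ge0//.
- by rewrite addr_ge0// fine_ge0.
- by rewrite lerDl fine_ge0.
Qed.

Lemma majorant_exp w : majorant r be l2 sg w ^+ r = 1 + fine (wsum r be l2 sg w).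
Proof.
rewrite -powR_mulrn ?powR_ge0// -powRrM mulVf ?pnatr_eq0 -?lt0n// powRr1//.
by rewrite addr_ge0// fine_ge0.
Qed.

Lemma integrable_majorant :
  (bernoulli_nu R).-integrable setT (fun w => (majorant r be l2 sg w ^+ r)%:E).
Proof.
have -> : (fun w => (majorant r be l2 sg w ^+ r)%:E) =
    ((EFin \o cst 1%R) \+ (EFin \o (fine \o wsum r be l2 sg)))%E.
  by apply/funext => w; rewrite /= majorant_exp EFinD.
apply: integrableD => //; first exact: finite_measure_integrable_cst.
apply: (le_integrable measurableT _ _ integrable_wsum).
  apply/measurable_EFinP; apply: measurableT_comp => //; exact: measurable_wsum.
move=> w _; rewrite /= !gee0_abs ?lee_fin ?fine_ge0//.
have := wsum_ge0 w; case: (wsum _ _ _ _ _) => [s||] //=; rewrite ?leey// !lee_fin => s0.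
by rewrite ger0_norm.
Qed.

(** A single term of the nonnegative series Z is at most 1 + Z = Y^r; then take r-th roots. *)
Lemma weight_le_majorant w m : good r be l2 sg w ->
  weight be l2 w m <= majorant r be l2 sg w * sg ^+ m.
Proof.
move=> Gw; rewrite -ler_pdivrMr ?exprn_gt0//.
rewrite -(@ler_pXn2r _ r)// ?nnegrE; last 2 first.
- by rewrite divr_ge0 ?weight_ge0 ?exprn_ge0// ltW.
- exact: powR_ge0.
rewrite majorant_exp ler_wpDl//.
rewrite -lee_fin fineK//.
have := @nneseries_lim_ge R (term^~ w) xpredT 0 m.+1 (fun n _ _ => term_ge0 n w).
apply: le_trans; rewrite big_nat_recr//= leeDr//.
by apply: sume_ge0 => i _; exact: term_ge0.
Qed.

End majorant_lemmas.

(** * The stationary measure *)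

Definition partial_X (R : realType) (l1 l2 d1 d2 : R) (n : nat) (w : Sigma) : R :=
  series (fun m => weight l1 l2 w m * letter d1 d2 (w m)) n.

Lemma measurable_partial_X (R : realType) (l1 l2 d1 d2 : R) (n : nat) :
  measurable_fun setT (partial_X l1 l2 d1 d2 n).
Proof.
apply: (@measurable_fun_prefix _ _ _ n) => w w' ww.
rewrite /partial_X /series/= !big_mkord; apply: eq_bigr => i _.
rewrite (@weight_prefix _ _ _ _ w w') ?ww// => j ji.
by rewrite ww// (ltn_trans ji).
Qed.

Lemma measurable_X (R : realType) (l1 l2 d1 d2 : R) :
  measurable_fun setT (X l1 l2 d1 d2 : Sigma -> measurableTypeR R).
Proof.
by apply: (@measurable_limn R _ _ (partial_X l1 l2 d1 d2)); exact: measurable_partial_X.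
Qed.

HB.instance Definition _ (R : realType) (l1 l2 d1 d2 : R) :=
  isMeasurableFun.Build _ _ _ _ (X l1 l2 d1 d2 : Sigma -> measurableTypeR R)
    (measurable_X l1 l2 d1 d2).

Lemma partial_X_scons (R : realType) (l1 l2 d1 d2 : R) (s : bool) (n : nat) (w : Sigma) :
  partial_X l1 l2 d1 d2 n.+1 (scons s w) =
    letter l1 l2 s * partial_X l1 l2 d1 d2 n w + letter d1 d2 s.
Proof.
rewrite /partial_X /series/= big_nat_recl//= addrC mulr_sumr; congr (_ + _).
  by apply: eq_bigr => i _; rewrite weight_scons mulrA.
by rewrite /weight big_ord0 mul1r.
Qed.

Lemma X_scons (R : realType) (l1 l2 d1 d2 : R) (s : bool) (w : Sigma) :
  cvgn (partial_X l1 l2 d1 d2 ^~ w) ->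
  X l1 l2 d1 d2 (scons s w) = letter l1 l2 s * X l1 l2 d1 d2 w + letter d1 d2 s.
Proof.
move=> cw; apply/cvg_lim => //.
rewrite -(cvg_shiftn 1).
have -> : (fun n => series (fun m => weight l1 l2 (scons s w) m *
    letter d1 d2 (scons s w m)) (n + 1)%N) =
  (fun n => letter l1 l2 s * partial_X l1 l2 d1 d2 n w + letter d1 d2 s).
  by apply/funext => n; rewrite addn1 -partial_X_scons.
by apply: cvgD; [exact: cvgMr|exact: cvg_cst].
Qed.

Section stationary.
Context {R : realType} (a b d1 d2 : R).
Let nu := bernoulli_nu R.
Let g (s : bool) (z : measurableTypeR R) : measurableTypeR R :=
  (letter a b s * z + letter d1 d2 s)%R.

Let measurable_g s : measurable_fun setT (g s).
Proof. by apply: measurable_funD => //; apply: measurable_funM. Qed.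

(* G z averages f over the images of z under the random compositions of n maps. *)
Lemma stationary_integral_iter (mu : probability (measurableTypeR R) R)
    (n : nat) (f : measurableTypeR R -> \bar R) :
  is_stationary d1 d2 a b mu -> measurable_fun setT f -> (forall x, (0 <= f x)%E) ->
  let G z := (\int[nu]_w f (partial_X a b d1 d2 n w + weight a b w n * z)%R)%E in
  measurable_fun setT G /\ (\int[mu]_z f z = \int[mu]_z G z)%E.
Proof.
move=> st; elim: n f => [|n IH] f mf f0 G.
  suff -> : G = f by [].
  apply/funext => z; rewrite /G.
  under eq_integral do rewrite /partial_X /weight /series/= big_geq// big_ord0 add0r mul1r.
  by rewrite integral_cst//= [X in (_ * X)%E]probability_setT mule1.
(* The first letter gives the outermost map, so the induction hypothesis is applied to
   [f \o g s]. *)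
have mfg s : measurable_fun setT (f \o g s) by exact: measurableT_comp.
have fg0 s x : (0 <= (f \o g s) x)%E by exact: f0.
pose Gs s z := (\int[nu]_w (f \o g s) (partial_X a b d1 d2 n w + weight a b w n * z)%R)%E.
have GE : G = (fun z => (2^-1)%:E * Gs true z + (2^-1)%:E * Gs false z)%E.
  apply/funext => z; rewrite /G.
  rewrite (ge0_integral_half_mixture (measurable_scons true) (measurable_scons false)
    (@bernoulli_scons R))//.
    by congr (_ * _ + _ * _)%E; apply: eq_integral => w _;
      rewrite partial_X_scons weight_scons /g/=; congr f; ring.
  apply: measurableT_comp => //; apply: measurable_funD.
    exact: measurable_partial_X.
  by apply: measurable_funM => //; exact: measurable_weight.
have [mG1 E1] := IH _ (mfg true) (fg0 true).
have [mG2 E2] := IH _ (mfg false) (fg0 false).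
have Gs0 s z : (0 <= Gs s z)%E by apply: integral_ge0 => w _; exact: fg0.
have half0 : (0 <= (2^-1 : R)%:E)%E by rewrite lee_fin invr_ge0.
have mGs s : measurable_fun setT (fun z => (2^-1)%:E * Gs s z)%E.
  by apply: measurable_funeM; case: s.
split; first by rewrite GE; apply: emeasurable_funD.
rewrite GE ge0_integralD//; last 4 first.
- by move=> z _; rewrite mule_ge0.
- exact: (mGs true).
- by move=> z _; rewrite mule_ge0.
- exact: (mGs false).
rewrite !ge0_integralZl//.
rewrite [LHS](@ge0_integral_half_mixture _ _ _ _ _ mu mu (g true) (g false))//.
by rewrite -E1 -E2.
Qed.

End stationary.

Section stationary_law.
Context {R : realType} (a b d1 d2 : R) (D : set Sigma).
Let nu := bernoulli_nu R.
Hypotheses (mD : measurable D) (D0 : nu (~` D) = 0%E)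
  (D_cvg : forall w, D w -> cvgn (partial_X a b d1 d2 ^~ w))
  (D_weight : forall w, D w -> weight a b w n @[n --> \oo] --> 0).
Let Xm : {mfun Sigma >-> measurableTypeR R} := X a b d1 d2.

(** Prepending s to w applies the map s to [X] on D, and the Bernoulli measure is the half mixture
    of its images under the two prependings. *)
Lemma stationary_law : is_stationary d1 d2 a b (distribution nu Xm).
Proof.
move=> A mA.
have eqD (B C : set Sigma) : measurable B -> measurable C ->
    (forall w, D w -> B w <-> C w) -> nu B = nu C.
  move=> mB mC BC.
  have mDc := measurableC mD.
  rewrite -(measureU0 mB mDc D0) -(measureU0 mC mDc D0); congr (nu _).
  apply/seteqP; split => w [H|H]; (try by right); have [Dw|] := pselect (D w);
    by [move=> ?; right|left; apply/BC].
have mX (B : set (measurableTypeR R)) : measurable B -> measurable (Xm @^-1` B).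
  by move=> mB; rewrite -[X in measurable X]setTI; exact: (measurable_funP Xm).
have mg s : measurable_fun setT
    (fun x : measurableTypeR R => letter a b s * x + letter d1 d2 s : measurableTypeR R)%R.
  by apply: measurable_funD => //; apply: measurable_funM.
have E s : nu (scons s @^-1` (Xm @^-1` A)) =
    nu (Xm @^-1` ((fun x => letter a b s * x + letter d1 d2 s)%R @^-1` A)).
  apply: eqD.
  - by rewrite -[X in measurable X]setTI; apply: measurable_scons => //; exact: mX.
  - by apply: mX; rewrite -[X in measurable X]setTI; exact: mg.
  - by move=> w Dw; rewrite /preimage/= X_scons//; exact: D_cvg.
have := bernoulli_scons R (mX _ mA).
by rewrite /pushforward -/nu (E true) (E false).
Qed.

(** Dominated convergence is used twice: over Sigma it gives, for each z, that G_n(z) tends to the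
    mean of f(X), since the weight times z tends to 0; over [mu] it passes to the limit in the
    integral of G_n, which is constant in n. *)
Lemma stationary_integral_continuous (mu : probability (measurableTypeR R) R) (f : R -> R) :
  is_stationary d1 d2 a b mu -> continuous f -> (forall x, 0 <= f x <= 1) ->
  (\int[mu]_z (f z)%:E = \int[distribution nu Xm]_z (f z)%:E)%E.
Proof.
move=> st cf f01.
have mf : measurable_fun setT (fun z : measurableTypeR R => (f z)%:E).
  by apply/measurable_EFinP; exact: continuous_measurable_fun.
have f0 x : (0 <= (f x)%:E)%E by rewrite lee_fin; case/andP: (f01 x).
rewrite ge0_integral_distribution//.
pose G n z := (\int[nu]_w (f (partial_X a b d1 d2 n w + weight a b w n * z)%R)%:E)%E.
have GE n : measurable_fun setT (G n) /\ (\int[mu]_z (f z)%:E = \int[mu]_z G n z)%E.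
  exact: (@stationary_integral_iter R a b d1 d2 mu n (fun z => (f z)%:E)).
have mfn n z : measurable_fun setT
    (fun w => (f (partial_X a b d1 d2 n w + weight a b w n * z)%R)%:E).
  apply: (measurableT_comp mf); apply: measurable_funD.
    exact: measurable_partial_X.
  by apply: measurable_funM => //; exact: measurable_weight.
have Gcvg z : G n z @[n --> \oo] --> (\int[nu]_w (f (Xm w))%:E)%E.
  have := @dominated_convergence _ _ _ nu setT measurableT
    (fun n w => (f (partial_X a b d1 d2 n w + weight a b w n * z)%R)%:E)
    (fun w => (f (Xm w))%:E) (cst 1%E) (mfn ^~ z) (measurableT_comp mf (measurable_funP Xm)).
  move=> /(_ _ _ _)[|||_ _] //.
  - exists (~` D); split => //; first exact: measurableC.
    apply: subsetC => w Dw _; apply: cvg_EFin; first exact: nearW.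
    apply: continuous_cvg; first exact: cf.
    rewrite -[X in _ --> X]addr0 -[X in _ --> _ + X](mul0r z).
    by apply: cvgD; [exact: D_cvg|apply: cvgMl; exact: D_weight].
  - exact: finite_measure_integrable_cst.
  - apply: aeW => w n _; rewrite lee_fin ger0_norm//;
      by case/andP: (f01 (partial_X a b d1 d2 n w + weight a b w n * z)).
have G0 n z : (0 <= G n z)%E by apply: integral_ge0.
have G1 n z : (G n z <= 1)%E.
  have <- : (\int[nu]_w 1 = 1)%E by rewrite integral_cst// mul1e; exact: probability_setT.
  apply: ge0_le_integral => // w _; rewrite lee_fin.
  by case/andP: (f01 (partial_X a b d1 d2 n w + weight a b w n * z)).
have := @dominated_convergence _ _ _ mu setT measurableT G
    (cst (\int[nu]_w (f (Xm w))%:E)%E) (cst 1%E) (fun n => (GE n).1) (measurable_cst _).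
have E n : (\int[mu]_z G n z = \int[mu]_z (f z)%:E)%E by rewrite -(GE n).2.
move=> /(_ _ _ _)[|||_ _].
- by apply: aeW => z _; exact: Gcvg.
- exact: finite_measure_integrable_cst.
- by apply: aeW => z n _; rewrite gee0_abs.
rewrite (_ : [sequence _]_n = cst (\int[mu]_z (f z)%:E)%E); last exact/funext.
rewrite integral_cst// [X in (_ * X)%E]probability_setT mule1.
by move=> H; apply: (cvg_unique _ (cvg_cst _) H); exact: ereal_hausdorff.
Qed.

(** Open rays generate the Borel sets, and their indicators are limits of continuous functions with
    values in [0, 1], to which the previous lemma applies. *)
Lemma stationary_unique (mu : probability (measurableTypeR R) R) :
  is_stationary d1 d2 a b mu ->
  forall A, measurable A -> mu A = distribution nu Xm A.
Proof.
move=> st.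
(* min 1 (max 0 (k (y - x))), which increases to the indicator of ]x, +oo[ *)
pose f (x : R) (k : nat) (y : R) : R := (`|k%:R * (y - x)| - `|k%:R * (y - x) - 1| + 1) / 2.
have cf x k : continuous (f x k).
  move=> y; apply: cvgMl; apply: cvgD; last exact: cvg_cst.
  have h : k%:R * (z - x) @[z --> y] --> k%:R * (y - x).
    by apply: cvgMr; apply: cvgB; [exact: cvg_id|exact: cvg_cst].
  by apply: cvgB; apply: cvg_norm => //; apply: cvgB => //; exact: cvg_cst.
have f01 x k y : 0 <= f x k y <= 1.
  rewrite /f; set u := k%:R * (y - x).
  have := ler_normD (u - 1) 1; have := ler_normB u 1; rewrite subrK normr1; lra.
have fE x k y : f x k y = if y <= x then 0 else if 1 <= k%:R * (y - x) then 1 else f x k y.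
  rewrite /f; case: ifPn => [yx|_].
    have u0 : k%:R * (y - x) <= 0 by rewrite mulr_ge0_le0// subr_le0.
    by rewrite !ler0_norm//; lra.
  case: ifPn => // u1; rewrite !ger0_norm; lra.
have ray (m : probability (measurableTypeR R) R) (x : R) :
    (\int[m]_z (f x k z)%:E)%E @[k --> \oo] --> m `]x, +oo[%classic.
  have mray : measurable (`]x, +oo[%classic : set (measurableTypeR R)) by exact: measurable_itv.
  have mf k : measurable_fun setT (fun z : measurableTypeR R => (f x k z)%:E).
    by apply/measurable_EFinP; exact: continuous_measurable_fun.
  have := @dominated_convergence _ _ _ m setT measurableT (fun k z => (f x k z)%:E)
    (fun z => (\1_(`]x, +oo[%classic : set (measurableTypeR R)) z)%:E) (cst 1%E) mf.
  move=> /(_ _ _ _ _)[||||_ _].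
  - by apply/measurable_EFinP; exact: measurable_indic.
  - apply: aeW => y _; apply: cvg_EFin; first exact: nearW.
    rewrite indicE; have [xy|yx] := ltP x y.
      rewrite mem_set/= ?in_itv/= ?xy//; apply: cvg_near_cst.
      near=> k; rewrite /= fE leNgt xy/=.
      have : (y - x)^-1 <= k%:R by near: k; exact: nbhs_infty_ger.
      rewrite -[X in X <= _]mul1r ler_pdivrMr ?subr_gt0// => ->.
      by [].
    rewrite memNset/= ?in_itv/= ?andbT; last by apply/negP; rewrite -leNgt.
    by apply: cvg_near_cst; apply: nearW => k; rewrite /= fE yx.
  - exact: finite_measure_integrable_cst.
  - by apply: aeW => y k _; case/andP: (f01 x k y) => ? ?; rewrite lee_fin ger0_norm.
  by rewrite integral_indic// setIT.
pose M : {measure set (measurableTypeR R) -> \bar R} := distribution nu Xm.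
suff H A : measurable A -> mu A = M A by [].
apply: (@measure_unique _ R (measurableTypeR R) (@RGenOInfty.G R)
    (fun n => `](- n%:R)%R, +oo[%classic) _ _ _ _ mu M).
- exact: RGenOInfty.measurableE.
- move=> _ _ [x ->] [y ->]; exists (Num.max x y).
  by apply/seteqP; split => z /=; rewrite !in_itv/= !andbT gt_max; [move=> [-> ->]|move=> /andP[]].
- by move=> n; exists (- n%:R).
- apply/seteqP; split => // x _.
  have [n _ /(_ n (leqnn n)) xn] := nbhs_infty_ger (- x + 1).
  by exists n => //=; rewrite in_itv/= andbT ltrNl; rewrite /= in xn; lra.
- move=> _ [x ->].
  have E k : (\int[distribution nu Xm]_z (f x k z)%:E = \int[mu]_z (f x k z)%:E)%E.
    by rewrite (stationary_integral_continuous st).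
  have := ray mu x; have := ray (distribution nu Xm) x.
  under eq_fun do rewrite E.
  by move=> h1 h2; exact: (cvg_unique _ h2 h1).
- by move=> n; apply: le_lt_trans (probability_le1 _ _) (ltry _); exact: measurable_itv.
Unshelve. all: by end_near. Qed.

End stationary_law.

(** * Derivatives of X and domination *)

Lemma ones_le (w : Sigma) (m : nat) : (ones w m <= m)%N.
Proof.
rewrite /ones -[leqRHS]card_ord -sum1_card; apply: leq_sum => i _; exact: leq_b1.
Qed.

Lemma ones_prefix (m : nat) (w w' : Sigma) :
  (forall i, (i < m)%N -> w i = w' i) -> ones w m = ones w' m.
Proof. by move=> ww; apply: eq_bigr => i _; rewrite ww. Qed.

Lemma weight_ones (R : realType) (l1 l2 : R) (w : Sigma) (m : nat) :
  weight l1 l2 w m = l1 ^+ ones w m * l2 ^+ (m - ones w m).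
Proof.
elim: m => [|m IH]; first by rewrite /weight /ones !big_ord0 expr0 mulr1.
rewrite /weight big_ord_recr/= -/(weight _ _ _ _) IH.
have -> : ones w m.+1 = (ones w m + w m)%N by rewrite /ones big_ord_recr.
case: (w m); rewrite /letter ?addn1 ?addn0.
  by rewrite subSS exprSr; ring.
by rewrite subSn ?ones_le// exprSr; ring.
Qed.

Section term_derivatives.
Context {R : realType} (l2 d1 d2 : R).

(** Isolates the dependence on the first parameter x: term m of the series is this coefficient times
    x^(o(m)). *)
Definition Xcoef (w : Sigma) (m : nat) : R := l2 ^+ (m - ones w m) * letter d1 d2 (w m).

Definition Xj (j : nat) (x : R) (w : Sigma) : R :=
  limn (series (monoser (Xcoef w) (ones w) j x)).

Lemma measurable_Xj (j : nat) (x : R) : measurable_fun setT (Xj j x).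
Proof.
apply: (@measurable_limn R _ _ (fun n w => series (monoser (Xcoef w) (ones w) j x) n)) => n.
apply: (@measurable_fun_prefix _ _ _ n) => w w' ww.
rewrite /series/= !big_mkord; apply: eq_bigr => i _.
have wi k : (k < i)%N -> w k = w' k by move=> ki; rewrite ww// (ltn_trans ki).
by rewrite /monoser /Xcoef (ones_prefix wi) ww.
Qed.

Lemma measurable_Xder (j : nat) (x : R) : measurable_fun setT (Xder x l2 d1 d2 j).
Proof.
apply: measurable_funM => //.
apply: (@measurable_limn R _ _ (fun n w => series (fun m => weight x l2 w m.+1 *
  letter d1 d2 (w m.+1) * 'C(ones w m.+1, j)%:R) n)) => n.
apply: (@measurable_fun_prefix _ _ _ n.+1) => w w' ww.
rewrite /series/= !big_mkord; apply: eq_bigr => i _.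
have wi k : (k < i.+1)%N -> w k = w' k by move=> ki; rewrite ww// (leq_trans ki)// ltnW// ltnS.
by rewrite (ones_prefix wi) (weight_prefix _ _ wi) ww// ltnS.
Qed.

Lemma X_Xj (x : R) (w : Sigma) : X x l2 d1 d2 w = Xj 0 x w.
Proof.
congr (limn (series _)); apply/funext => m.
by rewrite weight_ones /monoser /Xcoef ffactn0 mul1r subn0; ring.
Qed.

(** The two series differ by the common factor j!/x^j and by a shift: term m = 0 vanishes because
    o(0) = 0 < j. *)
Lemma Xder_Xj (j : nat) (x : R) (w : Sigma) : (0 < j)%N -> 0 < x ->
  cvgn (series (monoser (Xcoef w) (ones w) j x)) -> Xder x l2 d1 d2 j w = Xj j x w.
Proof.
move=> j0 x0 cw; rewrite /Xder.
set c := j`!%:R / x ^+ j; set t := series _.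
have c0 : c != 0 by rewrite mulf_neq0 ?invr_eq0 ?expf_neq0 ?gt_eqF// pnatr_eq0 -lt0n fact_gt0.
have E n : series (monoser (Xcoef w) (ones w) j x) n.+1 = c * t n.
  rewrite /t /series/= big_nat_recl// {1}/monoser /ones big_ord0 ffact_small// mul0r mulr0 add0r.
  rewrite mulr_sumr; apply: eq_bigr => i _.
  rewrite /monoser weight_ones /Xcoef /c -/(ones _ _).
  have [oj|jo] := ltnP (ones w i.+1) j.
    by rewrite ffact_small// bin_small// !mul0r !mulr0.
  have -> : x ^+ ones w i.+1 = x ^+ (ones w i.+1 - j) * x ^+ j by rewrite -exprD subnK.
  rewrite -bin_ffact natrM.
  by field; rewrite expf_neq0 ?gt_eqF.
have h : c * t n @[n --> \oo] --> Xj j x w.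
  move: cw => /cvg_ex[L cL].
  have -> : Xj j x w = L by apply/cvg_lim.
  rewrite -(cvg_shiftn 1) in cL; apply: cvg_trans cL; apply: near_eq_cvg.
  by apply: nearW => n; rewrite /= addn1 E.
have ht : t n @[n --> \oo] --> c^-1 * Xj j x w.
  have -> : t = (fun n => c^-1 * (c * t n)) by apply/funext => n; rewrite mulKf.
  exact: cvgMr.
by rewrite (cvg_lim _ ht)// mulVKf.
Qed.

End term_derivatives.

(** Descending induction from order r: the mean value theorem between 0 and y costs one factor |y|
    per order. *)
Lemma derive1n_growth (R : realType) (r : nat) (phi : R -> R) (k : nat) :
  isCr r phi -> has_ubound (range (fun x => `|derive1n r phi x|)) -> (k <= r)%N ->
  exists2 C : R, 0 <= C & forall y, `|derive1n k phi y| <= C * (1 + `|y|) ^+ (r - k).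
Proof.
move=> [dphi _] [M HM] kr.
suff H i : (i <= r)%N ->
    exists2 C : R, 0 <= C & forall y, `|derive1n (r - i) phi y| <= C * (1 + `|y|) ^+ i.
  by have := H _ (leq_subr k r); rewrite subKn.
elim: i => [_|i IH ir].
  exists `|M| => // y; rewrite subn0 expr0 mulr1 (le_trans _ (ler_norm _))//.
  by apply: HM; exists y.
have [C C0 HC] := IH (ltnW ir).
set n := (r - i.+1)%N; have En : n.+1 = (r - i)%N by rewrite /n; lia.
have nr : (n < r)%N by rewrite /n; lia.
have df (y : R) : is_derive y 1 (derive1n n phi) (derive1n (r - i) phi y).
  by rewrite -En derive1nS derive1E; apply: DeriveDef => //; exact: dphi.
have cf : continuous (derive1n n phi).
  by move=> y; apply/differentiable_continuous/derivable1_diffP; exact: dphi.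
exists (`|derive1n n phi 0| + C) => [|y]; first by rewrite addr_ge0.
have mid : exists2 c, `|c| <= `|y| &
    derive1n n phi y - derive1n n phi 0 = derive1n (r - i) phi c * y.
  have [y0|y0|<-] := ltgtP 0 y.
  - have [c] := MVT y0 (fun z _ => df z) (continuous_subspaceT cf).
    rewrite in_itv/= subr0 => /andP[c0 cy] E; exists c => //.
    by rewrite !gtr0_norm// ltW.
  - have [c] := MVT y0 (fun z _ => df z) (continuous_subspaceT cf).
    rewrite in_itv/= sub0r => /andP[cy c0] E; exists c.
      by rewrite !ltr0_norm// lerN2 ltW.
    by apply: oppr_inj; rewrite opprB E mulrN.
  - by exists 0; rewrite ?subrr ?mulr0.
have [c cy E] := mid.
have y1 : 0 <= `|y| by [].
have p1 : 1 <= (1 + `|y|) ^+ i by rewrite exprn_ege1// lerDl.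
have pc : (1 + `|c|) ^+ i <= (1 + `|y|) ^+ i.
  by rewrite lerXn2r ?nnegrE ?addr_ge0// lerD2l.
have -> : derive1n n phi y = derive1n n phi 0 + derive1n (r - i) phi c * y by rewrite -E; ring.
rewrite (le_trans (ler_normD _ _))// normrM exprS.
have hc : `|derive1n (r - i) phi c| <= C * (1 + `|y|) ^+ i.
  by apply: le_trans (HC c) _; rewrite ler_wpM2l.
have := ler_wpM2r y1 hc.
have n0 : 0 <= `|derive1n n phi 0| by [].
move: p1; set p := (1 + `|y|) ^+ i => p1 h.
rewrite mulrDl; apply: lerD.
  rewrite -[leLHS]mulr1 ler_wpM2l//; nra.
apply: le_trans h _; rewrite -mulrA ler_wpM2l// mulrC; nra.
Qed.

Lemma norm_powc_le (R : realType) (A y : nat -> R) (Y : R) (k n : nat) : 0 <= Y ->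
  (forall j, 0 <= A j) -> (forall j, `|y j| <= A j * Y) ->
  `|powc y k n| <= powc A k n * Y ^+ k.
Proof.
move=> Y0 A0 yA; elim: k n => [|k IH] n /=; first by rewrite expr0 mulr1 normr_nat.
rewrite (le_trans (ler_norm_sum _ _ _))// mulr_suml; apply: ler_sum => i _.
rewrite normrM exprSr mulrACA; exact: ler_pM.
Qed.

Lemma powc_ge0 (R : realType) (A : nat -> R) (k n : nat) :
  (forall j, 0 <= A j) -> 0 <= powc A k n.
Proof.
move=> A0; elim: k n => [|k IH] n //=.
by apply: sumr_ge0 => i _; rewrite mulr_ge0.
Qed.

(** The summand k contributes Y^(r-k) through phi^(k)(X) and Y^k through the k factors of the
    product, hence Y^r for every k. *)
Lemma norm_faa_sum_le (R : realType) (r l : nat) (phi : R -> R) (K : nat -> R) :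
  isCr r phi -> has_ubound (range (fun x => `|derive1n r phi x|)) -> (l <= r)%N ->
  (forall j, 0 <= K j) ->
  exists2 C : R, 0 <= C & forall (X : nat -> R) (Y : R), 1 <= Y ->
    (forall j, `|X j| <= K j * Y) -> `|faa_sum phi X l| <= C * Y ^+ r.
Proof.
move=> phiC phib lr K0.
have /choice[G HG] : forall k, exists G : R, 0 <= G /\ ((k <= r)%N ->
    forall y, `|derive1n k phi y| <= G * (1 + `|y|) ^+ (r - k)).
  move=> k; have [kr|kr] := leqP k r; last by exists 0; split.
  by have [C C0 HC] := derive1n_growth phiC phib kr; exists C.
pose A j := if j is 0%N then 0 else K j / j`!%:R.
have A0 j : 0 <= A j by case: j => // j; rewrite /A divr_ge0.
pose C k := G k * (1 + K 0%N) ^+ (r - k) / k`!%:R * powc A k l.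
have C0 k : 0 <= C k.
  by rewrite /C mulr_ge0 ?powc_ge0// divr_ge0// mulr_ge0 ?(HG k).1// exprn_ge0// addr_ge0.
exists (l`!%:R * \sum_(k < l.+1) C k).
  by rewrite mulr_ge0// sumr_ge0// => k _; exact: C0.
move=> X Y Y1 XK; have Y0 : 0 <= Y by exact: le_trans Y1.
rewrite /faa_sum normrM ger0_norm// -mulrA ler_wpM2l// (le_trans (ler_norm_sum _ _ _))//.
rewrite mulr_suml; apply: ler_sum => -[k kl] _ /=.
have kr : (k <= r)%N by apply: leq_trans lr; rewrite -ltnS.
rewrite normrM normf_div (ger0_norm (ler0n _ _)).
have -> : C k * Y ^+ r =
    (G k * (1 + K 0%N) ^+ (r - k) * Y ^+ (r - k)) / k`!%:R * (powc A k l * Y ^+ k).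
  by rewrite -{1}(subnK kr) exprD /C; ring.
apply: ler_pM => //.
  rewrite ler_wpM2r ?invr_ge0//.
  apply: le_trans ((HG k).2 kr _) _.
  have K1 : 0 <= 1 + K 0%N by rewrite addr_ge0.
  rewrite -mulrA ler_wpM2l ?(HG k).1// -exprMn lerXn2r ?nnegrE ?addr_ge0 ?mulr_ge0//.
  by have := XK 0%N; rewrite mulrDl mul1r; lra.
apply: norm_powc_le => // -[|j]; first by rewrite normr0 mul0r.
by rewrite normf_div (ger0_norm (ler0n _ _)) /A mulrAC ler_wpM2r ?invr_ge0.
Qed.

(** * Differentiation under the integral sign *)

Section integral_ae_nonmeasurable.
Import HBNNSimple.
Context {d : measure_display} {T : measurableType d} {R : realType}.
Variable mu : {measure set T -> \bar R}.
Variable N : set T.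
Hypotheses (mN : measurable N) (N0 : mu N = 0%E).

(** A simple function below f becomes one below g, with the same integral, when multiplied by the
    indicator of the complement of N. *)
Let ge0_le_integral_null (f g : T -> \bar R) :
  (forall x, (0 <= f x)%E) -> (forall x, (0 <= g x)%E) -> (forall x, ~ N x -> f x = g x) ->
  (\int[mu]_x f x <= \int[mu]_x g x)%E.
Proof.
move=> f0 g0 fg; rewrite !ge0_integralTE//.
apply: ge_ereal_sup => _ [h hf <-]; apply: ereal_sup_ubound.
exists (proj_nnsfun h (measurableC mN)) => [x|].
  rewrite /= mindicE; case: (boolP (x \in ~` N)) => [|_].
    by rewrite inE => /fg <-; rewrite mulr1; exact: hf.
  by rewrite mulr0.
rewrite -!integralT_nnsfun; apply: ge0_ae_eq_integral => //.
- by apply/measurable_EFinP; exact: measurable_funP.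
- by apply/measurable_EFinP; exact: measurable_funP.
- by move=> x _; rewrite lee_fin.
- by move=> x _; rewrite lee_fin.
exists N; split => // x /= H; apply: contrapT => Nx; apply: H => _.
by rewrite /= mindicE mem_set// mulr1.
Qed.

Let ge0_eq_integral_null (f g : T -> \bar R) :
  (forall x, (0 <= f x)%E) -> (forall x, (0 <= g x)%E) -> (forall x, ~ N x -> f x = g x) ->
  (\int[mu]_x f x = \int[mu]_x g x)%E.
Proof.
move=> f0 g0 fg; apply/eqP; rewrite eq_le; apply/andP; split.
  exact: ge0_le_integral_null.
by apply: ge0_le_integral_null => // x /fg.
Qed.

(* Unlike ge0_ae_eq_integral, this holds without any measurability, because the
   integral is a lower one: it is a supremum over simple functions. *)
Lemma Rintegral_eq_off_null (f g : T -> R) : (forall x, ~ N x -> f x = g x) ->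
  \int[mu]_x f x = \int[mu]_x g x.
Proof.
move=> fg; rewrite /Rintegral integralE [in RHS]integralE; congr (fine (_ - _)).
  by apply: ge0_eq_integral_null => // x /fg; rewrite !funeposE/= => ->.
by apply: ge0_eq_integral_null => // x /fg; rewrite !funenegE/= => ->.
Qed.

End integral_ae_nonmeasurable.

Lemma is_derive_addl (R : realType) (F : R -> R) (a x dF : R) :
  is_derive (a + x) 1 F dF -> is_derive x 1 (fun t : R => F (a + t)) dF.
Proof.
move=> dFx.
have h : is_derive x 1 (fun t : R => a + t) 1.
  have := is_deriveD (is_derive_cst a x 1) (is_derive_id x (1 : R)).
  by rewrite add0r.
by have := is_derive1_comp dFx h; rewrite mulr1.
Qed.

(** Continuity at x leaves room on its right; this lemma supplies [be], and the next one [sg]. *)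
Lemma exists_exprn_lt (R : realType) (r : nat) (x c z : R) :
  x < z -> x ^+ r < c -> exists2 y, x < y < z & y ^+ r < c.
Proof.
move=> xz xc; near x^'+ => y; exists y.
  by apply/andP; split; near: y; [exact: nbhs_right_gt|exact: nbhs_right_lt].
near: y; apply: (cvgr_lt (x ^+ r)) => //.
apply: cvg_at_right_filter; exact: exprn_continuous.
Unshelve. all: by end_near. Qed.

Lemma exists_exprn_gt (R : realType) (r : nat) (x c z : R) :
  z < x -> c < x ^+ r -> exists2 y, z < y < x & c < y ^+ r.
Proof.
move=> zx xc; near x^'- => y; exists y.
  by apply/andP; split; near: y; [exact: nbhs_left_gt|exact: nbhs_left_lt].
near: y; apply: (cvgr_gt (x ^+ r)) => //.
apply: cvg_at_left_filter; exact: exprn_continuous.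
Unshelve. all: by end_near. Qed.

(** * Domination on the parameter interval and derivatives of the integral *)

Section differentiation.
Context {R : realType} (r : nat) (l2 d1 d2 al be sg : R) (phi : R -> R).
Hypotheses (r_gt0 : (0 < r)%N) (al_gt0 : 0 < al) (l2_gt0 : 0 < l2) (al_lt : al < be)
  (sg01 : 0 < sg < 1) (q_lt : (be ^+ r + l2 ^+ r) / 2 < sg ^+ r).
Hypotheses (phi_Cr : isCr r phi) (phi_bd : has_ubound (range (fun x => `|derive1n r phi x|))).

Let nu := bernoulli_nu R.
Let G := good r be l2 sg.
Let Y := majorant r be l2 sg.
Let Xt := Xj l2 d1 d2.
Let D := `|d1| + `|d2|.
Let F l x w := faa_sum phi (fun j => Xt j x w) l.
(** Restricting to G makes every estimate hold pointwise; [integrable_agree] returns to integrals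
    over Sigma. *)
Let H l x := \int[nu]_(w in G) F l x w.

Let be_gt0 : 0 < be. Proof. exact: lt_trans al_lt. Qed.
Let sg_gt0 : 0 < sg. Proof. by case/andP: sg01. Qed.
Let D0 : 0 <= D. Proof. exact: addr_ge0. Qed.
Let mG : measurable G. Proof. exact: measurable_good. Qed.
Let G0 : nu (~` G) = 0%E. Proof. exact: good_ae. Qed.
Let Y1 w : 1 <= Y w. Proof. exact: majorant_ge1. Qed.
Let Y0 w : 0 <= Y w. Proof. exact: le_trans (Y1 w). Qed.

(** At x = be the term is a weight times a translation d1 or d2, so the majorant applies. *)
Let Xcoef_le w m : G w ->
  `|Xcoef l2 d1 d2 w m| * be ^+ ones w m <= D * Y w * sg ^+ m.
Proof.
move=> Gw; rewrite /Xcoef normrM ger0_norm ?exprn_ge0 ?(ltW l2_gt0)//.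
rewrite mulrAC mulrC (_ : l2 ^+ _ * _ = weight be l2 w m); last by rewrite weight_ones mulrC.
rewrite -mulrA; apply: ler_pM => //; first by rewrite weight_ge0 ?ltW.
  by rewrite /D; case: (w m); rewrite /letter ?lerDl ?lerDr.
exact: weight_le_majorant.
Qed.

Let in_cc (x : R) : x \in `]al, be[ -> al <= x <= be.
Proof. by rewrite in_itv/= => /andP[/ltW-> /ltW->]. Qed.

Let Xj_bound : exists K : nat -> R, (forall j, 0 <= K j) /\
  forall j x w, G w -> x \in `]al, be[ ->
  cvgn (series (monoser (Xcoef l2 d1 d2 w) (ones w) j x)) /\ `|Xt j x w| <= K j * Y w.
Proof.
have /choice[K HK] : forall j, exists K : R, 0 <= K /\ forall x w, G w -> x \in `]al, be[ ->
  cvgn (series (monoser (Xcoef l2 d1 d2 w) (ones w) j x)) /\ `|Xt j x w| <= K * Y w.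
  move=> j; have [K K0 HK] := monoser_bound be j al_gt0 sg01.
  exists (K * D); split => [|x w Gw xab]; first exact: mulr_ge0.
  rewrite -mulrA; apply: HK; last exact: in_cc.
  - exact: mulr_ge0.
  - exact: ones_le.
  - by move=> m; exact: Xcoef_le.
by exists K; split => j; [exact: (HK j).1|exact: (HK j).2].
Qed.

Lemma cvgn_monoser j x w : G w -> x \in `]al, be[ ->
  cvgn (series (monoser (Xcoef l2 d1 d2 w) (ones w) j x)).
Proof. by have [K [_ HK]] := Xj_bound => Gw xab; have [] := HK j x w Gw xab. Qed.

Let is_derive_F k x w : G w -> x \in `]al, be[ -> (k < r)%N ->
  is_derive x 1 (fun t => F k t w) (F k.+1 x w).
Proof.
move=> Gw xab kr; apply: (@is_derive_faa_sum _ _ (fun j t => Xt j t w)) => [j|i ik].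
  by apply: (is_derive_monoser j al_gt0 sg01 _ (ones_le w) _ xab) => [|m];
    [exact: mulr_ge0 D0 (Y0 w)|exact: Xcoef_le].
by apply: phi_Cr.1; exact: leq_ltn_trans kr.
Qed.

Let F_bound l : (l <= r)%N -> exists2 C : R, 0 <= C &
  forall x w, G w -> x \in `]al, be[ -> `|F l x w| <= C * Y w ^+ r.
Proof.
move=> lr; have [K [K0 HK]] := Xj_bound.
have [C C0 HC] := norm_faa_sum_le phi_Cr phi_bd lr K0.
by exists C => // x w Gw xab; apply: HC => // j; exact: (HK j x w Gw xab).2.
Qed.

Let continuous_derive1n k : (k <= r)%N -> continuous (derive1n k phi).
Proof.
rewrite leq_eqVlt => /predU1P[->|kr]; first exact: phi_Cr.2.
by move=> x; apply/differentiable_continuous/derivable1_diffP; exact: phi_Cr.1.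
Qed.

Lemma measurable_powc (d : measure_display) (T : measurableType d) (y : nat -> T -> R) k n :
  (forall j, measurable_fun setT (y j)) -> measurable_fun setT (fun w => powc (y ^~ w) k n).
Proof.
move=> my; elim: k n => [|k IH] n; first exact: measurable_cst.
by apply: measurable_sum => i; apply: measurable_funM.
Qed.

Lemma measurable_faa_sum (d : measure_display) (T : measurableType d) (X : nat -> T -> R) l :
  (l <= r)%N -> (forall j, measurable_fun setT (X j)) ->
  measurable_fun setT (fun w => faa_sum phi (X ^~ w) l).
Proof.
move=> lr mX; apply: measurable_funM => //; apply: measurable_sum => i.
apply: measurable_funM; first apply: measurable_funM => //.
  apply: (measurableT_comp _ (mX 0%N)); apply: continuous_measurable_fun.
  by apply: continuous_derive1n; rewrite (leq_trans _ lr)// -ltnS.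
apply: (@measurable_powc _ _ (fun j w => if j is 0%N then 0 else X j w / j`!%:R)) => -[|j].
  exact: measurable_cst.
exact: measurable_funM.
Qed.

Let measurable_F l x : (l <= r)%N -> measurable_fun setT (F l x).
Proof.
move=> lr; apply: (@measurable_faa_sum _ _ (fun j w => Xt j x w)) => // j.
exact: measurable_Xj.
Qed.

Let integrable_Yr : nu.-integrable G (EFin \o (fun w => Y w ^+ r)).
Proof. by apply: integrableS (integrable_majorant _ _ _ _ _). Qed.

Let integrable_F l x : (l <= r)%N -> x \in `]al, be[ -> nu.-integrable G (EFin \o F l x).
Proof.
move=> lr xab; have [C C0 HC] := F_bound lr.
apply: (@le_integrable _ _ _ _ _ _ _ (EFin \o (fun w => C * Y w ^+ r))) => //.
- by apply/measurable_EFinP/measurable_funTS; exact: measurable_F.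
- move=> w Gw; rewrite /= lee_fin [leRHS]ger0_norm; first exact: HC.
  by rewrite mulr_ge0// exprn_ge0.
by have := integrableZl mG C integrable_Yr.
Qed.

Lemma integrable_agree l x (f : Sigma -> R) : (l <= r)%N -> x \in `]al, be[ ->
  measurable_fun setT f -> (forall w, G w -> f w = F l x w) ->
  nu.-integrable setT (EFin \o f) /\ \int[nu]_w f w = H l x.
Proof.
move=> lr xab mf fF.
have GD : setT `\` ~` G = G by rewrite setTD setCK.
have intf : nu.-integrable setT (EFin \o f).
  apply/(negligible_integrable (measurableC mG)) => //; first exact/measurable_EFinP.
  rewrite GD; apply: eq_integrable (integrable_F lr xab) => // w.
  by rewrite inE => Gw; rewrite /= fF.
split=> //; rewrite /H /Rintegral; congr fine.
rewrite (negligible_integral (measurableC mG))// GD.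
by apply: eq_integral => w; rewrite inE => Gw; rewrite fF.
Qed.

(** On G the function C Y^r dominates F of order k+1 simultaneously for all parameters in the
    interval, as differentiation under the integral requires. *)
Let is_derive_H k x : x \in `]al, be[ -> (k < r)%N -> is_derive x 1 (H k) (H k.+1 x).
Proof.
move=> xab kr; have [C C0 HC] := F_bound kr.
have dF y w : `]al, be[%classic y -> G w -> derivable (F k ^~ w) y 1.
  by move=> yab Gw; have [] := is_derive_F Gw yab kr.
have pE y w : `]al, be[%classic y -> G w -> partial1of2 (F k) y w = F k.+1 y w.
  by move=> yab Gw; rewrite partial1of2E; have [] := is_derive_F Gw yab kr.
have intF y : `]al, be[%classic y -> nu.-integrable G (EFin \o F k y).
  by move=> yab; apply: integrable_F => //; exact: ltnW.
have intC : nu.-integrable G (EFin \o (fun w => C * Y w ^+ r)).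
  by have := integrableZl mG C integrable_Yr.
have CY0 w : 0 <= C * Y w ^+ r by rewrite mulr_ge0// exprn_ge0.
have bnd y w : `]al, be[%classic y -> G w -> `|partial1of2 (F k) y w| <= C * Y w ^+ r.
  by move=> yab Gw; rewrite pE//; exact: HC.
apply: DeriveDef.
  exact: (derivable_under_integral mG xab intF dF CY0 intC bnd).
rewrite -derive1E (differentiation_under_integral mG xab intF dF CY0 intC bnd).
by apply: eq_Rintegral => w; rewrite inE => Gw; exact: pE.
Qed.

Let partial_XE x n w :
  partial_X x l2 d1 d2 n w = series (monoser (Xcoef l2 d1 d2 w) (ones w) 0 x) n.
Proof.
apply: eq_bigr => m _.
by rewrite weight_ones /monoser /Xcoef ffactn0 mul1r subn0; ring.
Qed.

Let F0 x w : F 0 x w = phi (X x l2 d1 d2 w).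
Proof.
by rewrite X_Xj /F /faa_sum big_ord_recl big_ord0 addr0 /= fact0 divr1 mulr1 mul1r.
Qed.

Let cvgn_partial_X x w : x \in `]al, be[ -> G w -> cvgn (partial_X x l2 d1 d2 ^~ w).
Proof.
move=> xab Gw; rewrite (_ : partial_X x l2 d1 d2 ^~ w =
  series (monoser (Xcoef l2 d1 d2 w) (ones w) 0 x)); first exact: cvgn_monoser.
by apply/funext => n; rewrite partial_XE.
Qed.

Let cvgn_weight x w : x \in `]al, be[ -> G w -> weight x l2 w n @[n --> \oo] --> 0.
Proof.
move=> /in_cc/andP[ax xb] Gw; have x0 : 0 <= x by rewrite (le_trans _ ax)// ltW.
apply: (@squeeze_cvgr _ _ _ _ (cst 0) (geometric (Y w) sg)).
- apply: nearW => n; rewrite weight_ge0 ?(ltW l2_gt0)//=.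
  apply: (le_trans _ (weight_le_majorant _ _ _ _ _ Gw)) => //.
  rewrite !weight_ones ler_wpM2r ?exprn_ge0 ?(ltW l2_gt0)//.
  by rewrite lerXn2r// nnegrE ltW.
- exact: cvg_cst.
- by apply: cvg_geometric; rewrite gtr0_norm//; case/andP: sg01.
Qed.

Let Xm x : {mfun Sigma >-> measurableTypeR R} := X x l2 d1 d2.

(** The law of [X] shows that the set in the choice operator is nonempty; hence the chosen measure
    is stationary, and uniqueness identifies it with that law. *)
Let stationary_measureE x : x \in `]al, be[ -> forall A, measurable A ->
  stationary_measure d1 d2 x l2 A = distribution nu (Xm x) A.
Proof.
move=> xab.
have law : is_stationary d1 d2 x l2 (distribution nu (Xm x)).
  by apply: (stationary_law mG G0) => w Gw; exact: cvgn_partial_X.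
have st : is_stationary d1 d2 x l2 (stationary_measure d1 d2 x l2).
  exact: (@getPex _ [set mu | is_stationary d1 d2 x l2 mu] (ex_intro _ _ law)).
by apply: (stationary_unique mG G0) st => w Gw; [exact: cvgn_partial_X|exact: cvgn_weight].
Qed.

Let integral_stationary x : x \in `]al, be[ ->
  (stationary_measure d1 d2 x l2).-integrable setT (EFin \o phi) /\
  \int[stationary_measure d1 d2 x l2]_z phi z = H 0 x.
Proof.
move=> xab.
have mphi : measurable_fun setT (phi : measurableTypeR R -> R).
  by apply: continuous_measurable_fun; exact: (@continuous_derive1n 0%N).
have mphiX : measurable_fun setT (phi \o Xm x).
  exact: (measurableT_comp mphi (measurable_funP (Xm x))).
have [intX intE] := integrable_agree (leq0n r) xab mphiX (fun w _ => esym (F0 x w)).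
have E (f : measurableTypeR R -> \bar R) :
    (\int[stationary_measure d1 d2 x l2]_z f z = \int[distribution nu (Xm x)]_z f z)%E.
  by apply: eq_measure_integral => A mA _; exact: stationary_measureE.
split.
  apply/integrableP; split; first exact/measurable_EFinP.
  rewrite E ge0_integral_distribution//; last first.
    by apply: measurableT_comp => //; exact/measurable_EFinP.
  by case/integrableP: intX.
rewrite -intE /Rintegral E integral_distribution//; exact/measurable_EFinP.
Qed.

Variable l1 : R.
Hypothesis l1ab : l1 \in `]al, be[.

Let shift_ab e : e \in `]al - l1, be - l1[ -> l1 + e \in `]al, be[.
Proof. by rewrite !in_itv/= => /andP[? ?]; apply/andP; split; lra. Qed.

Let zero_ab : 0 \in `]al - l1, be - l1[.
Proof. by move: l1ab; rewrite !in_itv/= => /andP[? ?]; apply/andP; split; lra. Qed.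

Let faa_di_bruno_F l w : G w -> faa_di_bruno l1 l2 d1 d2 phi l w = F l l1 w.
Proof.
move=> Gw; rewrite /faa_di_bruno.
rewrite (sum_bell_index l (fun k => derive1n k phi (X l1 l2 d1 d2 w))
  (fun j => Xder l1 l2 d1 d2 j w)).
rewrite /F /faa_sum (_ : Xt 0 l1 w = X l1 l2 d1 d2 w) ?X_Xj//.
congr (_ * _); apply: eq_bigr => k _; congr (_ * powc _ _ _).
apply/funext => -[|j] //; rewrite Xder_Xj//.
  by move: l1ab; rewrite in_itv/= => /andP[+ _]; exact: lt_trans.
exact: cvgn_monoser.
Qed.

Let measurable_faa l : (l <= r)%N -> measurable_fun setT (faa_di_bruno l1 l2 d1 d2 phi l).
Proof.
move=> lr.
(* Measurability concerns all of Sigma, while [Xder] is identified with [Xt] only on G; the sequence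
   is therefore built from [X] and [Xder] themselves. *)
pose Z j w := if j is 0%N then X l1 l2 d1 d2 w else Xder l1 l2 d1 d2 j w.
rewrite (_ : faa_di_bruno _ _ _ _ _ _ = fun w => faa_sum phi (Z ^~ w) l); last first.
  apply/funext => w; rewrite /faa_di_bruno (sum_bell_index l
    (fun k => derive1n k phi (X l1 l2 d1 d2 w)) (Z ^~ w)).
  by [].
apply: measurable_faa_sum => // -[|j]; last exact: measurable_Xder.
exact: measurable_X.
Qed.

Let phiX (w : Sigma) (e : R) := phi (X (l1 + e) l2 d1 d2 w).

Let phiX_chain w : G w ->
  {in `]al - l1, be - l1[, phiX w =1 (fun e : R => F 0 (l1 + e) w)} /\
  (forall k, (k < r)%N -> {in `]al - l1, be - l1[, forall e : R,
     is_derive e 1 (fun e : R => F k (l1 + e) w) (F k.+1 (l1 + e) w)}).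
Proof.
move=> Gw; split=> [e _|k kr e eab]; first by rewrite F0.
by apply: (@is_derive_addl _ (fun t => F k t w)); apply: is_derive_F => //; exact: shift_ab.
Qed.

Lemma differentiation_stationary :
  let mu := fun eps => stationary_measure d1 d2 (l1 + eps) l2 in
  let h := fun eps => \int[mu eps]_x phi x in
  [/\ \forall eps \near (0 : R), (mu eps).-integrable setT (EFin \o phi),
      derivable_upto r h 0 &
      forall l : nat, (1 <= l <= r)%N ->
      [/\ {ae nu, forall w, derivable_upto l (phiX w) 0},
          ae_integrable nu (fun w => derive1n l (phiX w) 0),
          nu.-integrable setT (EFin \o faa_di_bruno l1 l2 d1 d2 phi l),
          derive1n l h 0 = \int[nu]_w derive1n l (phiX w) 0 &
          \int[nu]_w derive1n l (phiX w) 0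
            = \int[nu]_w faa_di_bruno l1 l2 d1 d2 phi l w]].
Proof.
move=> mu h.
have hH : {in `]al - l1, be - l1[, h =1 (fun e : R => H 0 (l1 + e))}.
  by move=> e /shift_ab eab; exact: (integral_stationary eab).2.
have dH k : (k < r)%N -> {in `]al - l1, be - l1[, forall e : R,
    is_derive e 1 (fun e : R => H k (l1 + e)) (H k.+1 (l1 + e))}.
  by move=> kr e /shift_ab eab; apply: is_derive_addl; exact: is_derive_H.
split.
- near=> e; apply: (integral_stationary _).1; apply: shift_ab.
  by near: e; exact: near_in_itvoo.
- exact: (derivable_upto_chain zero_ab hH dH).
move=> l /andP[l1r lr].
have [intf intE] := integrable_agree lr l1ab (measurable_faa lr) (fun w => @faa_di_bruno_F l w).
have dl w : G w -> derive1n l (phiX w) 0 = faa_di_bruno l1 l2 d1 d2 phi l w.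
  move=> Gw; have [E dE] := phiX_chain Gw.
  by rewrite (derive1n_chain E dE)// addr0 faa_di_bruno_F.
have ED : \int[nu]_w derive1n l (phiX w) 0 = \int[nu]_w faa_di_bruno l1 l2 d1 d2 phi l w.
  (* The left integrand is controlled only on G, so the comparison uses the form that asks for no
     measurability. *)
  apply: (Rintegral_eq_off_null (measurableC mG) G0) => w /contrapT; exact: dl.
split=> //.
- exists (~` G); split => //; first exact: measurableC.
  apply: subsetC => w Gw; have [E dE] := phiX_chain Gw.
  apply: (@derivable_upto_chain _ _ _ _ l _ (fun k e => F k (l1 + e) w) zero_ab E) => k kl.
  by apply: dE; exact: leq_trans lr.
- exists (faa_di_bruno l1 l2 d1 d2 phi l) => //.
  exists (~` G); split => //; first exact: measurableC.
  by apply: subsetC => w; exact: dl.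
- by rewrite ED intE (derive1n_chain hH dH)// addr0.
Unshelve. all: by end_near. Qed.

End differentiation.

Theorem theorem1p1 (R : realType) (r : nat) (l1 l2 d1 d2 : R) (phi : R -> R)
    (r_ge1 : (1 <= r)%N)
    (l1_gt0 : 0 < l1) (l1_lt1 : l1 < 1) (l2_gt1 : 1 < l2)
    (contract : (l1 ^+ r + l2 ^+ r) / 2 < 1)
    (fixpts : d1 / (1 - l1) <> d2 / (1 - l2))
    (phi_Cr : isCr r phi)
    (phi_bd : has_ubound (range (fun x => `|derive1n r phi x|))) :
  let mu := fun eps => stationary_measure d1 d2 (l1 + eps) l2 in
  let nu := bernoulli_nu R in
  let h := fun eps => \int[mu eps]_x phi x in
  let phiX := fun (w : Sigma) (eps : R) => phi (X (l1 + eps) l2 d1 d2 w) in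
  [/\ \forall eps \near (0 : R), (mu eps).-integrable setT (EFin \o phi),
      derivable_upto r h 0 &
      forall l : nat, (1 <= l <= r)%N ->
      [/\ {ae nu, forall w, derivable_upto l (phiX w) 0},
          ae_integrable nu (fun w => derive1n l (phiX w) 0),
          nu.-integrable setT (EFin \o faa_di_bruno l1 l2 d1 d2 phi l),
          derive1n l h 0 = \int[nu]_w derive1n l (phiX w) 0 &
          \int[nu]_w derive1n l (phiX w) 0
            = \int[nu]_w faa_di_bruno l1 l2 d1 d2 phi l w]].
Proof.
(* The hypothesis says l1^r < 2 - l2^r, and the bound on be^r keeps the mean of be^r and l2^r below
   1 = 1^r, which leaves room for sg < 1. *)
have [be /andP[l1be _] be_lt] : exists2 be, l1 < be < 1 & be ^+ r < 2 - l2 ^+ r.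
  by apply: exists_exprn_lt => //; lra.
have [sg sg01 q_lt] : exists2 sg, 0 < sg < 1 & (be ^+ r + l2 ^+ r) / 2 < sg ^+ r.
  by apply: exists_exprn_gt => //; rewrite expr1n; lra.
(* The left end l1/2 keeps the parameters away from 0, where the bounds in negative powers of al
   would fail. *)
have l1ab : l1 \in `]l1 / 2, be[ by rewrite in_itv/=; apply/andP; split; lra.
have al0 : 0 < l1 / 2 by lra.
have l20 : 0 < l2 by lra.
have al_lt : l1 / 2 < be by lra.
exact: (differentiation_stationary d1 d2 r_ge1 al0 l20 al_lt sg01 q_lt phi_Cr phi_bd l1ab).
Qed.
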